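(* Let $D_Y\subset\mathcal{P}_Y$ be the chamber defined in the context. Under any isometry $S_Y\cong L_{10}$ that maps $\mathcal{P}_Y$ to $\mathcal{P}_{10}$, the chamber $D_Y$ is a union of exactly $2^{14}\cdot3\cdot5\cdot7\cdot17\cdot31=906608640$ Vinberg chambers.
   Context: Let $F(x_1,\dots,x_4)$ be a general complex cubic form, $\overline{X}\subset\mathbb{P}^3$ the quartic Hessian surface $\det(\partial^2F/\partial x_i\partial x_j)=0$, with ten ordinary nodes $p_\alpha$ and ten lines $\ell_\beta$, indexed by the set $A$ of $3$-subsets and the set $B$ of $2$-subsets of $\{1,\dots,5\}$ so that $p_\alpha\in\ell_\beta$ iff $\beta\subset\alpha$. Let $X\to\overline{X}$ be the minimal resolution (a K3 surface), $E_\alpha$ the exceptional curve over $p_\alpha$, $L_\beta$ the strict transform of $\ell_\beta$; the classes $[E_\alpha],[L_\beta]$ generate the Néron–Severi lattice $S_X$, with $\langle E_\alpha,E_{\alpha'}\rangle=-2\delta_{\alpha\alpha'}$, $\langle L_\beta,L_{\beta'}\rangle=-2\delta_{\beta\beta'}$, $\langle E_\alpha,L_\beta\rangle=1$ if $\beta\subset\alpha$ and $0$ otherwise. $X$ has an Enriques involution $\varepsilon$ with $\varepsilon(E_\alpha)=L_{\bar\alpha}$ ($\bar\alpha$ the complement); $\pi:X\to Y=X/\langle\varepsilon\rangle$ is the quotient. $S_Y$ is the lattice of numerical classes of divisors on $Y$ with form $\langle\,,\rangle_Y$, and $\langle \pi^*y,\pi^*y'\rangle_X=2\langle y,y'\rangle_Y$.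 $\mathcal{P}_Y$ is the component of $\{y\in S_Y\otimes\mathbb{R}:\langle y,y\rangle_Y>0\}$ containing an ample class. For $\alpha\in A$, let $\bar u_\alpha\in S_Y$ be the class of the smooth rational curve $\pi(E_\alpha)=\pi(L_{\bar\alpha})$; let $v_\alpha\in S_X^\vee$ be the unique vector with $\langle v_\alpha,[E_{\alpha'}]\rangle_X=\delta_{\alpha\alpha'}$ for all $\alpha'\in A$ and $\langle v_\alpha,[L_\beta]\rangle_X=\delta_{\bar\alpha\beta}$ for all $\beta\in B$; and let $\bar v_\alpha\in S_Y\otimes\mathbb{Q}$ be the vector with $\langle\bar v_\alpha,y\rangle_Y=\langle v_\alpha,\pi^*y\rangle_X$ for all $y\in S_Y$. Put $D_Y=\{y\in\mathcal{P}_Y:\langle y,\bar u_\alpha\rangle_Y\ge0,\ \langle y,\bar v_\alpha\rangle_Y\ge0\ \forall\alpha\in A\}$. $L_{10}$ is the even unimodular hyperbolic lattice of rank 10 with a fixed positive cone $\mathcal{P}_{10}$; a Vinberg chamber is a standard fundamental domain of the Weyl group $W(L_{10})$ (generated by reflections in roots, i.e. vectors of square $-2$) acting on $\mathcal{P}_{10}$, i.e. the closure in $\mathcal{P}_{10}$ of a connected component of $\mathcal{P}_{10}\setminus\bigcup_r (r)^\perp$, $r$ running over all roots. *)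

(* Defs.v *)
From HB Require Import structures.
From mathcomp Require Import all_boot all_order all_algebra.
From mathcomp Require Import all_classical all_reals topology num_topology matrix_topology.
Set Implicit Arguments. Unset Strict Implicit. Unset Printing Implicit Defensive.
Import Order.TTheory GRing.Theory Num.Theory numFieldTopology.Exports.
Local Open Scope ring_scope.
Local Open Scope classical_set_scope.

Definition Aidx := {s : {set 'I_5} | #|s| == 3%N}.
Definition Bidx := {s : {set 'I_5} | #|s| == 2%N}.
(** generators of S_X: inl a = E_a, inr b = L_b *)
Definition Gen := (Aidx + Bidx)%type.

Definition gram (g h : Gen) : int :=
  match g, h with
  | inl a, inl a' => if a == a' then -2 else 0
  | inr b, inr b' => if b == b' then -2 else 0
  | inl a, inr b => if val b \subset val a then 1 else 0
  | inr b, inl a => if val b \subset val a then 1 else 0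
  end.

(** epsrel g h : the Enriques involution maps generator g to generator h
    (eps(E_a) = L_{complement a}, eps(L_b) = E_{complement b}). *)
Definition epsrel (g h : Gen) : bool :=
  match g, h with
  | inl a, inr b => val b == ~: val a
  | inr b, inl a => val a == ~: val b
  | _, _ => false
  end.

Section SX.
Variable R : realType.

(** Elements of S_X (resp. S_X (x) R) are represented by integer (resp. real)
    coefficient vectors c : Gen -> R, standing for  sum_g c g * [g]. *)
Definition bX (c d : Gen -> R) : R :=
  \sum_(g : Gen) \sum_(h : Gen) c g * (gram g h)%:~R * d h.

(** numerical equivalence of coefficient vectors (same class in S_X (x) R) *)
Definition numeq (c d : Gen -> R) : Prop :=
  forall g : Gen, \sum_(h : Gen) (gram g h)%:~R * (c h - d h) = 0.

Definition epsX (c : Gen -> R) : Gen -> R :=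
  fun h => \sum_(g : Gen) (if epsrel g h then c g else 0).

Definition pi_ubar (a : Aidx) : Gen -> R :=
  fun g => if (g == inl a) || epsrel (inl a) g then 1 else 0.

(** <v_a, g>_X for the generators g : delta on the E's, delta_{abar,b} on L_b *)
Definition vval (a : Aidx) (g : Gen) : R :=
  if (g == inl a) || epsrel (inl a) g then 1 else 0.

Definition vpair (a : Aidx) (c : Gen -> R) : R := \sum_(g : Gen) c g * vval a g.

(** <y, y'>_Y = <pi^star y, pi^star y'>_X / 2, with y, y' given through pi^star *)
Definition bY (c d : Gen -> R) : R := bX c d / 2.

(** pi^star of sum_a ubar_a = sum of all the generators; an effective class with
    positive square, hence in the positive component containing the ample cone *)
Definition pi_sum_ubar : Gen -> R := fun _ => 1.

Definition PY (c : Gen -> R) : Prop := 0 < bY c c /\ 0 < bY c pi_sum_ubar.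

Definition DY (c : Gen -> R) : Prop :=
  PY c /\ forall a : Aidx, 0 <= bY c (pi_ubar a) /\ 0 <= vpair a c.

(** * The lattice L_10 realised as Z^10 with Gram matrix M. *)
Definition intR (M : 'M[int]_10) : 'M[R]_10 := map_mx (fun z : int => z%:~R) M.

Definition bL (M : 'M[int]_10) (x y : 'rV[R]_10) : R := (x *m intR M *m y^T) 0 0.

Definition even_unimodular (M : 'M[int]_10) : Prop :=
  M^T = M /\ (forall i, (2 %| M i i)%Z) /\ (\det M = 1 \/ \det M = -1).

Definition poscone (M : 'M[int]_10) (h0 : 'rV[R]_10) : set 'rV[R]_10 :=
  [set x | 0 < bL M x x /\ 0 < bL M x h0].

Definition root10 (M : 'M[int]_10) (r : 'rV[int]_10) : Prop :=
  (r *m M *m r^T) 0 0 = -2.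

Definition walls (M : 'M[int]_10) : set 'rV[R]_10 :=
  [set x | exists r, root10 M r /\ bL M (map_mx (fun z : int => z%:~R) r) x = 0].

Definition vinberg_chamber (M : 'M[int]_10) (h0 : 'rV[R]_10)
    (C : set 'rV[R]_10) : Prop :=
  exists x, (poscone M h0 `\` walls M) x /\
    C = closure (connected_component (poscone M h0 `\` walls M) x) `&` poscone M h0.

Definition union_of_exactly (N : nat) (D : set 'rV[R]_10)
    (IsCh : set 'rV[R]_10 -> Prop) : Prop :=
  ([set C | IsCh C /\ C `<=` D] #= `I_N)%card /\
  D = \bigcup_(C in [set C | IsCh C /\ C `<=` D]) C.

Definition psiR (psi : 'I_10 -> Gen -> int) (x : 'rV[R]_10) : Gen -> R :=
  fun g => \sum_(i < 10) x 0 i * (psi i g)%:~R.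

Definition isometry_to_SY (M : 'M[int]_10) (psi : 'I_10 -> Gen -> int) : Prop :=
  (forall i, numeq (epsX (fun g => (psi i g)%:~R)) (fun g => (psi i g)%:~R)) /\
  (forall i j, bY (fun g => (psi i g)%:~R) (fun g => (psi j g)%:~R) = (M i j)%:~R) /\
  (forall c : Gen -> int,
      numeq (epsX (fun g => (c g)%:~R)) (fun g => (c g)%:~R) ->
      exists z : 'rV[int]_10,
        numeq (fun g => (c g)%:~R) (psiR psi (map_mx (fun k : int => k%:~R) z))).

End SX.

(* Main.v *)
(** S_Y is the lattice of integral (d; y_1,...,y_10) with y_1 + ... + y_10 = 3d and form
    d d' - y.y', in which ubar and vbar become the 20 roots (1; neighbours of i) and
    (2; non-neighbours of i) of the Petersen graph, and h = (10; 3,...,3) measures the height d.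
    Two facts make the chamber D_Y tractable: x^2 is half the sum of the products
    <x, ubar_i> <x, vbar_i>, so the cone of the 20 walls lies in the closed positive cone; and the
    4-dimensional space V4 spanned by the vbar modulo 2, with its orthogonal V6, is respected by the
    reflections in the walls. An induction on the height then shows that no root lying in V4 or V6
    modulo 2 cuts the interior of D_Y.

    Vinberg chambers are the images of the standard E10 chamber under words g of root reflections.
    Fix a basis v of V4 of type A4 and send g to the quadruple g^-1 v modulo 2. If two chambers in
    D_Y have the same quadruple, they differ by an isometry fixing V4 and V6, hence preserving D_Y
    and its walls, hence trivial. Conversely every A4-quadruple of root classes in L/2L occurs:
    transvections act transitively on them, and an isometry trivial on V4 moves the chamber into
    D_Y, because the reflection in vbar_i agrees on V4 with an automorphism of the graph. So the
    number of chambers is the number of A4-quadruples, 496 * 240 * 119 * 64. *)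
Require Import Defs.
From HB Require Import structures.
From mathcomp Require Import all_boot all_order all_algebra.
From mathcomp Require Import all_classical all_reals topology num_topology matrix_topology.
From mathcomp Require Import zify ring lra normedtype.
Import Order.TTheory GRing.Theory Num.Theory numFieldTopology.Exports numFieldNormedType.Exports.
Local Open Scope ring_scope.
Set Implicit Arguments. Unset Strict Implicit. Unset Printing Implicit Defensive.

(** * The Lorentzian form *)

(** In group terms, the chambers in [D_Y] represent, once each, the orbits on all chambers of the
    group of words acting trivially on V4, and the count is the index of this group, |O+(10,2)| /
    |O-(6,2)| with |O-(6,2)| = |W(E6)| = 51840. The reflections in the vbar do not belong to the
    group, so Coxeter theory supplies neither the existence nor the uniqueness of a representative
    in [D_Y]; both are obtained from heights.

    The obstacle in a descent on the height of a root is a reflection that jumps below height 0. The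
    Gram inequality of two roots, projected off h, leaves only a few such jumps, and integrality or
    the classes modulo 2 dispose of these.

    Isometries are words of reflections: the inverse of a word is its reversal, and no matrix is
    ever formed. Finite checks range over the 496 root classes or the ten vertices of the graph,
    never over the chambers. *)

(* Vectors (d; y_1,...,y_10): coordinate 0 is d and coordinate k > 0 is y_k. *)
Definition coord (K : comNzRingType) (x : 'rV[K]_11) (k : nat) : K := x 0 (inord k).

Definition lor (K : comNzRingType) (x y : 'rV[K]_11) : K :=
  coord x 0 * coord y 0 - \sum_(1 <= k < 11) coord x k * coord y k.

Definition balanced (K : comNzRingType) (x : 'rV[K]_11) : Prop :=
  \sum_(1 <= k < 11) coord x k = 3 * coord x 0.

Section Form.
Variable K : comNzRingType.
Implicit Types (x y z : 'rV[K]_11) (a : K).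

Lemma coordD x y k : coord (x + y) k = coord x k + coord y k.
Proof. by rewrite /coord mxE. Qed.
Lemma coordN x k : coord (- x) k = - coord x k.
Proof. by rewrite /coord mxE. Qed.
Lemma coordZ a x k : coord (a *: x) k = a * coord x k.
Proof. by rewrite /coord mxE. Qed.
Lemma coord0 k : coord (0 : 'rV[K]_11) k = 0.
Proof. by rewrite /coord mxE. Qed.

Lemma coordP x y : (forall k, (k < 11)%N -> coord x k = coord y k) -> x = y.
Proof.
move=> xy; apply/rowP => i.
by have := xy _ (ltn_ord i); rewrite /coord inord_val.
Qed.

Lemma lorC x y : lor x y = lor y x.
Proof. by rewrite /lor mulrC; congr (_ - _); apply: eq_bigr => k _; rewrite mulrC. Qed.

Lemma lorDl x y z : lor (x + y) z = lor x z + lor y z.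
Proof.
rewrite /lor coordD mulrDl.
under eq_bigr do rewrite coordD mulrDl.
by rewrite big_split /= opprD addrACA.
Qed.

Lemma lorZl a x z : lor (a *: x) z = a * lor x z.
Proof.
rewrite /lor coordZ mulrBr -mulrA; congr (_ - _).
by rewrite big_distrr; apply: eq_bigr => k _; rewrite coordZ -mulrA.
Qed.

Lemma lorDr x y z : lor x (y + z) = lor x y + lor x z.
Proof. by rewrite !(lorC x) lorDl. Qed.
Lemma lorZr a x z : lor x (a *: z) = a * lor x z.
Proof. by rewrite !(lorC x) lorZl. Qed.
Lemma lorNl x y : lor (- x) y = - lor x y.
Proof. by rewrite -scaleN1r lorZl mulN1r. Qed.
Lemma lorNr x y : lor x (- y) = - lor x y.
Proof. by rewrite !(lorC x) lorNl. Qed.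
Lemma lorBl x y z : lor (x - y) z = lor x z - lor y z.
Proof. by rewrite lorDl lorNl. Qed.
Lemma lorBr x y z : lor x (y - z) = lor x y - lor x z.
Proof. by rewrite lorDr lorNr. Qed.
Lemma lor0l x : lor 0 x = 0.
Proof. by rewrite -(subrr x) lorBl subrr. Qed.

Lemma balancedD x y : balanced x -> balanced y -> balanced (x + y).
Proof.
rewrite /balanced => bx by_; under eq_bigr do rewrite coordD.
by rewrite big_split /= bx by_ coordD mulrDr.
Qed.

Lemma balancedZ a x : balanced x -> balanced (a *: x).
Proof.
rewrite /balanced => bx; under eq_bigr do rewrite coordZ.
by rewrite -big_distrr /= bx coordZ mulrCA.
Qed.

Lemma balancedN x : balanced x -> balanced (- x).
Proof. by rewrite -scaleN1r; exact: balancedZ. Qed.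
Lemma balancedB x y : balanced x -> balanced y -> balanced (x - y).
Proof. by move=> bx by_; apply: balancedD => //; apply: balancedN. Qed.

Definition ivec (a : K) (s : seq nat) : 'rV[K]_11 :=
  \row_i (if (i == 0%N :> nat) then a else (val i \in s)%:R).
Definition dif (i j : nat) : 'rV[K]_11 :=
  \row_k ((k == i :> nat)%:R - (k == j :> nat)%:R).

Lemma coord_ivec a s k : (k < 11)%N ->
  coord (ivec a s) k = if k == 0%N then a else (k \in s)%:R.
Proof. by move=> k11; rewrite /coord mxE /= inordK. Qed.
Lemma coord_dif i j k : (k < 11)%N ->
  coord (dif i j) k = (k == i)%:R - (k == j)%:R.
Proof. by move=> k11; rewrite /coord mxE /= inordK. Qed.

Definition idx (s : seq nat) : bool := uniq s && all (fun k => (0 < k < 11)%N) s.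

Lemma sum_idx (F : nat -> K) s : idx s ->
  \sum_(1 <= k < 11) F k * (k \in s)%:R = \sum_(k <- s) F k.
Proof.
move=> /andP[us /allP sin].
transitivity (\sum_(k <- index_iota 1 11 | k \in s) F k).
  by rewrite [RHS]big_mkcond; apply: eq_bigr => k _; case: ifP; rewrite ?mulr1 ?mulr0.
rewrite -big_filter; apply: perm_big; apply: uniq_perm => //.
  by rewrite filter_uniq ?iota_uniq.
move=> k; rewrite mem_filter mem_index_iota.
by case ks: (k \in s) => //=; have := sin k ks.
Qed.

Lemma lor_ivec x a s : idx s ->
  lor x (ivec a s) = a * coord x 0 - \sum_(k <- s) coord x k.
Proof.
move=> hs; rewrite /lor coord_ivec //= mulrC -(sum_idx (coord x) hs); congr (_ - _).
apply: eq_big_nat => k /andP[k0 k1].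
by rewrite coord_ivec // gtn_eqF.
Qed.

Lemma lor_dif x i j : (0 < i < 11)%N -> (0 < j < 11)%N ->
  lor x (dif i j) = coord x j - coord x i.
Proof.
move=> hi hj; rewrite /lor coord_dif //.
have [-> ->] : (0%N == i) = false /\ (0%N == j) = false by lia.
rewrite subrr mulr0 sub0r.
have e k : (0 < k < 11)%N -> \sum_(1 <= l < 11) coord x l * (l == k)%:R = coord x k.
  move=> hk; have := @sum_idx (coord x) [:: k].
  rewrite /idx /= hk big_seq1 => <- //; apply: eq_bigr => l _; by rewrite inE.
rewrite -(e i) // -(e j) // -sumrB -sumrN !big_nat; apply: eq_bigr => k /andP[_ k11].
by rewrite coord_dif //; ring.
Qed.

Lemma balanced_dif i j : (0 < i < 11)%N -> (0 < j < 11)%N -> balanced (dif i j).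
Proof.
move=> hi hj; rewrite /balanced coord_dif //.
have [-> ->] : (0%N == i) = false /\ (0%N == j) = false by lia.
have e k : (0 < k < 11)%N -> \sum_(1 <= l < 11) ((l == k)%:R : K) = 1.
  move=> hk; transitivity (\sum_(l <- [:: k]) (1 : K)); last by rewrite big_seq1.
  rewrite -(@sum_idx (fun=> 1)) ?/idx /= ?hk //.
  by apply: eq_bigr => l _; rewrite mul1r inE.
rewrite subrr mulr0 -[RHS](subrr 1) -[X in X - _](e i) // -[X in _ - X](e j) // -sumrB.
by rewrite !big_nat; apply: eq_bigr => k /andP[_ k11]; rewrite coord_dif.
Qed.

Lemma balanced_ivec a s : idx s -> (size s)%:R = 3 * a -> balanced (ivec a s).
Proof.
move=> hs sa; rewrite /balanced coord_ivec //= -sa.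
transitivity (\sum_(l <- s) (1 : K)); last by rewrite -sum1_size natr_sum.
rewrite -(sum_idx (fun=> 1) hs); apply: eq_big_nat => k /andP[k0 k1].
by rewrite coord_ivec // mul1r; case: eqP k0 => [->|].
Qed.

Definition refl (r x : 'rV[K]_11) := x + lor x r *: r.
Definition act (w : seq 'rV[K]_11) (x : 'rV[K]_11) := foldr refl x w.

Lemma lor_sum x : lor x x = coord x 0 ^+ 2 - \sum_(1 <= k < 11) coord x k ^+ 2.
Proof. by rewrite /lor expr2; congr (_ - _); apply: eq_bigr => k _; rewrite expr2. Qed.

End Form.

(** * Cauchy-Schwarz and the positive cone *)

(** Multiplying the difference of the two sides by [B] gives a sum of squares without any division,
    so that integers are covered; [B = 0] is settled apart. *)
Lemma cauchy_schwarz (K : realDomainType) (s : seq nat) (a b : nat -> K) :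
  (\sum_(i <- s) a i * b i) ^+ 2 <= (\sum_(i <- s) a i ^+ 2) * (\sum_(i <- s) b i ^+ 2).
Proof.
set S := \sum_(i <- s) a i * b i; set A := \sum_(i <- s) _; set B := \sum_(i <- s) _.
have B0 : 0 <= B by apply: sumr_ge0 => i _; apply: sqr_ge0.
have key : 0 <= B * (A * B - S ^+ 2).
  have -> : B * (A * B - S ^+ 2) = \sum_(i <- s) (a i * B - b i * S) ^+ 2.
    transitivity (\sum_(i <- s) (B ^+ 2 * a i ^+ 2 + (- (2 * B * S)) * (a i * b i)
                                 + S ^+ 2 * b i ^+ 2)); last first.
      by apply: eq_bigr => i _; ring.
    by rewrite !big_split /= -!mulr_sumr -/S -/A -/B; ring.
  by apply: sumr_ge0 => i _; apply: sqr_ge0.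
have [B_gt0|] := ltrP 0 B; first by move: key; rewrite pmulr_rge0 // subr_ge0.
move=> Ble; have Beq : B = 0 by apply: le_anti; rewrite Ble.
have b0 i : i \in s -> b i = 0.
  move=> si; have /eqP := Beq; rewrite psumr_eq0; last by move=> j _; apply: sqr_ge0.
  by move=> /allP /(_ i si); rewrite /= sqrf_eq0 => /eqP.
suff -> : S = 0 by rewrite Beq mulr0 expr0n.
by rewrite /S big_seq big1 // => i si; rewrite b0 // mulr0.
Qed.

Section Cone.
Variable K : realDomainType.
Implicit Types x y : 'rV[K]_11.

Lemma spatial_ge0 x : 0 <= \sum_(1 <= k < 11) coord x k ^+ 2.
Proof. by apply: sumr_ge0 => i _; apply: sqr_ge0. Qed.

Lemma lor_lt x y : 0 < lor x x -> 0 < lor y y ->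
  (\sum_(1 <= k < 11) coord x k * coord y k) ^+ 2 < (coord x 0 * coord y 0) ^+ 2.
Proof.
move=> hx hy; have := cauchy_schwarz (index_iota 1 11) (coord x) (coord y).
have := spatial_ge0 x; have := spatial_ge0 y; move: hx hy; rewrite !lor_sum.
set A := \sum_(_ <= _ < _) _; set B := \sum_(_ <= _ < _) _; set S := \sum_(_ <= _ < _) _.
move=> hx hy B0 A0 SAB; apply: (le_lt_trans SAB); rewrite exprMn.
have [->|A_n0] := eqVneq A 0; first by rewrite mul0r mulr_gt0 //; lra.
apply: (@lt_le_trans _ _ (A * coord y 0 ^+ 2)); first by rewrite ltr_pM2l; [lra|rewrite lt_def A_n0].
by rewrite ler_wpM2r //; [exact: sqr_ge0|lra].
Qed.

Lemma lor_gt0 x y : 0 < lor x x -> 0 < lor y y -> 0 < coord x 0 -> 0 < coord y 0 ->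
  0 < lor x y.
Proof.
move=> hx hy x0 y0; have := lor_lt hx hy; rewrite /lor subr_gt0 => h.
have xy0 : 0 < coord x 0 * coord y 0 by apply: mulr_gt0.
have [//|le] := ltrP _ (coord x 0 * coord y 0).
have : (coord x 0 * coord y 0) ^+ 2 <= (\sum_(1 <= k < 11) coord x k * coord y k) ^+ 2.
  by rewrite ler_sqr ?nnegrE ?(ltW xy0) // (le_trans (ltW xy0)).
by rewrite leNgt h.
Qed.

Lemma same_cone x y : 0 < lor x x -> 0 < lor y y -> 0 < coord x 0 -> 0 < lor x y ->
  0 < coord y 0.
Proof.
move=> hx hy x0 hxy; rewrite ltNge; apply/negP => y0.
have hy' : 0 < lor (- y) (- y) by rewrite lorNl lorNr opprK.
have yn0 : coord y 0 != 0.
  by apply: contraTneq hy => y00; rewrite -leNgt lor_sum y00 expr0n sub0r oppr_le0 spatial_ge0.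
have := @lor_gt0 x (- y) hx hy' x0; rewrite coordN oppr_gt0 lt_def eq_sym yn0 y0 lorNr => /(_ isT).
by rewrite oppr_gt0 => /(lt_trans hxy); rewrite ltxx.
Qed.
End Cone.

(** * Integral roots and words of reflections *)

Notation vec := 'rV[int]_11.

Definition is_root (r : vec) : Prop := balanced r /\ lor r r = -2.

Lemma refl_is_additive (r x y : vec) : refl r (x + y) = refl r x + refl r y.
Proof. by rewrite /refl lorDl scalerDl addrACA. Qed.

Lemma reflZ (r x : vec) a : refl r (a *: x) = a *: refl r x.
Proof. by rewrite /refl lorZl scalerDr scalerA. Qed.

Section Reflections.
Variable r : vec.
Hypothesis hr : is_root r.
Implicit Types x y : vec.

Lemma lor_refl x y : lor (refl r x) (refl r y) = lor x y.
Proof.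
have [_ rr] := hr.
by rewrite /refl !(lorDl, lorDr, lorZl, lorZr) rr (lorC r y); ring.
Qed.

Lemma reflK x : refl r (refl r x) = x.
Proof.
have [_ rr] := hr.
rewrite /refl lorDl lorZl rr -addrA -scalerDl.
have -> : lor x r + (lor x r + lor x r * -2) = 0 by ring.
by rewrite scale0r addr0.
Qed.

Lemma balanced_refl x : balanced x -> balanced (refl r x).
Proof. by have [br _] := hr => bx; apply: balancedD => //; apply: balancedZ. Qed.

Lemma root_refl x : is_root x -> is_root (refl r x).
Proof. by move=> [bx xx]; split; [apply: balanced_refl|rewrite lor_refl]. Qed.
End Reflections.

Definition rword (w : seq vec) : Prop := forall r, r \in w -> is_root r.

Lemma rword_cons r w : rword (r :: w) <-> is_root r /\ rword w.
Proof.
split=> [h|[hr hw] x]; first by split=> [|x xw]; apply: h; rewrite inE ?eqxx ?xw ?orbT.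
by rewrite inE => /orP[/eqP->|/hw].
Qed.

Lemma rword_cat w w' : rword w -> rword w' -> rword (w ++ w').
Proof. by move=> h h' x; rewrite mem_cat => /orP[/h|/h']. Qed.

Lemma rword_rev w : rword w -> rword (rev w).
Proof. by move=> h x; rewrite mem_rev; apply: h. Qed.

Lemma act_cat (w w' : seq vec) x : act (w ++ w') x = act w (act w' x).
Proof. by rewrite /act foldr_cat. Qed.

Lemma actD w (x y : vec) : act w (x + y) = act w x + act w y.
Proof. by elim: w => //= r w ->; rewrite refl_is_additive. Qed.

Lemma actZ w a (x : vec) : act w (a *: x) = a *: act w x.
Proof. by elim: w => //= r w ->; rewrite reflZ. Qed.

Lemma lor_act w (x y : vec) : rword w -> lor (act w x) (act w y) = lor x y.
Proof. by elim: w => //= r w IH /rword_cons[hr hw]; rewrite lor_refl // IH. Qed.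

Lemma balanced_act w x : rword w -> balanced x -> balanced (act w x).
Proof. by elim: w => //= r w IH /rword_cons[hr hw] bx; apply: balanced_refl => //; apply: IH. Qed.

Lemma root_act w x : rword w -> is_root x -> is_root (act w x).
Proof. by move=> hw [bx xx]; split; [apply: balanced_act|rewrite lor_act]. Qed.

Lemma actK w (x : vec) : rword w -> act (rev w) (act w x) = x.
Proof.
elim: w x => [//|r w IH] x /rword_cons[hr hw].
by rewrite rev_cons -cats1 act_cat /= reflK // IH.
Qed.

Lemma actKV w (x : vec) : rword w -> act w (act (rev w) x) = x.
Proof. by move=> hw; rewrite -{1}(revK w) actK //; apply: rword_rev. Qed.

Lemma act_adj w (x y : vec) : rword w -> lor (act w x) y = lor x (act (rev w) y).
Proof. by move=> hw; rewrite -{1}(actKV y hw) lor_act. Qed.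

Lemma act_cone w (x : vec) : rword w -> 0 < lor x x -> 0 < coord x 0 -> 0 < coord (act w x) 0.
Proof.
move=> + hx x0; elim: w => //= r w IH /rword_cons[hr hw].
apply: (@same_cone _ (act w x)); rewrite ?lor_refl // ?lor_act //; first exact: IH.
rewrite /refl lorDr lorZr lor_act //; apply: ltr_wpDr => //.
by rewrite -expr2 sqr_ge0.
Qed.

(** Cauchy-Schwarz in the negative definite complement of h = (10; 3,...,3): as h.h = 10 and x.h =
    d, ten times the projection of x has height 0 and coordinates 10 y_k - 3d. The bound limits how
    far one reflection can lower a height. *)
Lemma gram_roots (r e : vec) : is_root r -> is_root e ->
  5 * lor r e ^+ 2 - lor r e * coord r 0 * coord e 0 <= 20 + coord r 0 ^+ 2 + coord e 0 ^+ 2.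
Proof.
move=> [br rr] [be ee].
have := cauchy_schwarz (index_iota 1 11) (fun k => 10 * coord r k - 3 * coord r 0)
  (fun k => 10 * coord e k - 3 * coord e 0).
have E (x y : vec) : balanced x -> balanced y ->
    \sum_(1 <= k < 11) (10 * coord x k - 3 * coord x 0) * (10 * coord y k - 3 * coord y 0)
    = 10 * coord x 0 * coord y 0 - 100 * lor x y.
  rewrite /balanced /lor /index_iota /= !big_cons !big_nil => bx by_.
  have -> : coord x 10 = 3 * coord x 0 - (coord x 1 + coord x 2 + coord x 3 + coord x 4
    + coord x 5 + coord x 6 + coord x 7 + coord x 8 + coord x 9) by rewrite -bx; ring.
  have -> : coord y 10 = 3 * coord y 0 - (coord y 1 + coord y 2 + coord y 3 + coord y 4
    + coord y 5 + coord y 6 + coord y 7 + coord y 8 + coord y 9) by rewrite -by_; ring.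
  ring.
under [X in _ <= X * _]eq_bigr do rewrite expr2.
under [X in _ <= _ * X]eq_bigr do rewrite expr2.
rewrite !E // rr ee; nia.
Qed.

(* Neighbours, resp. non-neighbours, of the vertices of the Petersen graph. The vertices are the
   2-subsets of {0,...,4} in lexicographic order, numbered from 1; neighbours are disjoint. *)
Definition nbr : seq (seq nat) :=
  [:: [:: 8; 9; 10]; [:: 6; 7; 10]; [:: 5; 7; 9]; [:: 5; 6; 8]; [:: 3; 4; 10];
      [:: 2; 4; 9]; [:: 2; 3; 8]; [:: 1; 4; 7]; [:: 1; 3; 6]; [:: 1; 2; 5]]%N.
Definition nonnbr : seq (seq nat) :=
  [seq [seq k <- iota 1 10 | (k != i.+1) && (k \notin nth [::] nbr i)] | i <- iota 0 10].

(** * The cone of the twenty walls *)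

Definition ub (K : comNzRingType) (i : nat) : 'rV[K]_11 := ivec 1 (nth [::] nbr i).
Definition vb (K : comNzRingType) (i : nat) : 'rV[K]_11 := ivec 2 (nth [::] nonnbr i).

(** The adjacency matrix A of the Petersen graph satisfies A^2 + A - 2 = J, the all-ones matrix.
    Over the rationals put y = A s, so that s has sum d: the products with [ub i] and [vb i] are ((A
    - 2)s)_i and 2 s_i, while d^2 - y.y = s.(A - 2)s. *)
Lemma lor_petersen (K : comNzRingType) (x : 'rV[K]_11) : balanced x ->
  2 * lor x x = \sum_(i <- iota 0 10) lor x (ub K i) * lor x (vb K i).
Proof.
rewrite /= !big_cons big_nil /ub /vb /= !lor_ivec // !big_cons !big_nil /=.
rewrite /balanced /lor /index_iota /= !big_cons !big_nil => bx.
have -> : coord x 10 = 3 * coord x 0 - (coord x 1 + coord x 2 + coord x 3 + coord x 4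
    + coord x 5 + coord x 6 + coord x 7 + coord x 8 + coord x 9) by rewrite -bx; ring.
ring.
Qed.

Definition walls20 : seq vec := [seq ub int i | i <- iota 0 10] ++ [seq vb int i | i <- iota 0 10].

Lemma ub_wall i : (i < 10)%N -> ub int i \in walls20.
Proof. by move=> hi; rewrite mem_cat (map_f (ub int)) ?mem_iota. Qed.
Lemma vb_wall i : (i < 10)%N -> vb int i \in walls20.
Proof. by move=> hi; rewrite mem_cat (map_f (vb int)) ?mem_iota ?orbT. Qed.
Lemma wall20P e : e \in walls20 -> exists2 i, (i < 10)%N & e = ub int i \/ e = vb int i.
Proof.
by rewrite mem_cat => /orP[] /mapP[i]; rewrite mem_iota => hi ->; exists i; auto.
Qed.

Lemma norm_ge0 (x : vec) : balanced x -> (forall e, e \in walls20 -> 0 <= lor x e) ->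
  0 <= lor x x.
Proof.
move=> bx xw; suff : 0 <= 2 * lor x x by rewrite pmulr_rge0.
rewrite lor_petersen // big_seq; apply: sumr_ge0 => i; rewrite mem_iota => hi.
by apply: mulr_ge0; apply: xw; rewrite ?ub_wall ?vb_wall.
Qed.

(** A root has negative norm, so it lies outside the cone of [norm_ge0]. This supplies the wall
    along which each height induction descends. *)
Lemma wall_neg (r : vec) : is_root r -> exists2 e, e \in walls20 & lor r e < 0.
Proof.
move=> [br rr]; have [/hasP[e ew re]|/hasPn h] := boolP (has (fun e => lor r e < 0) walls20).
  by exists e.
have : 0 <= lor r r by apply: norm_ge0 => // e /h; rewrite -leNgt.
by rewrite rr.
Qed.

Lemma nbrP i : (i < 10)%N -> idx (nth [::] nbr i) /\ size (nth [::] nbr i) = 3%N.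
Proof.
have /all_nthP h : all (fun s => idx s && (size s == 3%N)) nbr by [].
by move=> /(h [::]) /andP[-> /eqP].
Qed.

Lemma nonnbrP i : (i < 10)%N -> idx (nth [::] nonnbr i) /\ size (nth [::] nonnbr i) = 6%N.
Proof.
have /all_nthP h : all (fun s => idx s && (size s == 6%N)) nonnbr by vm_compute.
by move=> /(h [::]) /andP[-> /eqP].
Qed.

(** A wall (2; six indices) is a sum of two triples, and [r] meets one of them negatively if it
    meets the wall negatively. *)
Lemma triple_neg (r : vec) : is_root r ->
  exists i j k, idx [:: i; j; k] /\ lor r (ivec 1 [:: i; j; k]) < 0.
Proof.
move=> hr; have [e /wall20P[n n10 [->|->]]] := wall_neg hr.
  rewrite /ub; have [] := nbrP n10; case: nth => [|i [|j [|k []]]] // hi _ h.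
  by exists i, j, k.
rewrite /vb; have [] := nonnbrP n10; case: nth => [|a [|b [|c [|d [|e' [|f []]]]]]] // h6 _.
have [ha hb] : idx [:: a; b; c] /\ idx [:: d; e'; f].
  move: h6; rewrite /idx -[[:: a, b, c, d & _]]/([:: a; b; c] ++ [:: d; e'; f]).
  by rewrite cat_uniq all_cat => /andP[/and3P[-> _ ->] /andP[-> ->]].
have [h|h] := ltrP (lor r (ivec 1 [:: a; b; c])) 0; first by exists a, b, c.
have [h'|h'] := ltrP (lor r (ivec 1 [:: d; e'; f])) 0; first by exists d, e', f.
by move: h h'; rewrite !lor_ivec // !big_cons !big_nil; lia.
Qed.

(** * Roots and the standard E10 chamber *)

Lemma int_le_sqr (z : int) : z <= z ^+ 2.
Proof. by rewrite expr2; nia. Qed.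

Lemma height0_eq0 (x : vec) : coord x 0 = 0 -> 0 <= lor x x -> x = 0.
Proof.
move=> x0; rewrite lor_sum x0 expr0n sub0r oppr_ge0 => le0.
have /eqP : \sum_(1 <= k < 11) coord x k ^+ 2 = 0.
  by apply: le_anti; rewrite le0 spatial_ge0.
rewrite psumr_eq0 => [/allP h|k _]; last exact: sqr_ge0.
apply: coordP => k k11; rewrite coord0.
case: (posnP k) => [->//|k0]; have := h k; rewrite mem_index_iota k0 k11 => /(_ isT).
by rewrite /= sqrf_eq0 => /eqP.
Qed.

(** Integrality gives 3|d| <= sum y_k^2 = d^2, so a nonzero isotropic vector has height at least 3
    in absolute value. *)
Lemma small_isotropic (x : vec) : balanced x -> lor x x = 0 -> `|coord x 0| <= 2 -> x = 0.
Proof.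
move=> bx xx x2; apply: height0_eq0; rewrite ?xx //.
have le1 : 3 * coord x 0 <= coord x 0 ^+ 2.
  rewrite -bx; move/eqP: xx; rewrite lor_sum subr_eq0 => /eqP->.
  by apply: ler_sum => k _; apply: int_le_sqr.
have le2 : - (3 * coord x 0) <= coord x 0 ^+ 2.
  rewrite -bx; move/eqP: xx; rewrite lor_sum subr_eq0 => /eqP->; rewrite -sumrN.
  by apply: ler_sum => k _; rewrite -sqrrN; apply: int_le_sqr.
by move: le1 le2 x2; rewrite expr2; nia.
Qed.

Lemma root_dif i j : (0 < i < 11)%N -> (0 < j < 11)%N -> i != j -> is_root (dif int i j).
Proof.
move=> hi hj ij; split; first exact: balanced_dif.
by rewrite lor_dif // !coord_dif; lia.
Qed.

Lemma root_height0 (r : vec) : is_root r -> coord r 0 = 0 ->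
  exists i j, [/\ (0 < i < 11)%N, (0 < j < 11)%N, i != j & r = dif int i j].
Proof.
move=> [br rr] r0.
have ex (x : vec) : balanced x -> lor x x = -2 -> coord x 0 = 0 ->
    exists2 i, (0 < i < 11)%N & 1 <= coord x i.
  move=> bx xx x0.
  have [/hasP[i]|/hasPn h] := boolP (has (fun k => 1 <= coord x k) (index_iota 1 11)).
    by rewrite mem_index_iota => hi xi; exists i.
  have neg k : k \in index_iota 1 11 -> 0 <= - coord x k by move=> /h; lia.
  have /eqP : \sum_(1 <= k < 11) (- coord x k) = 0 by rewrite sumrN bx x0.
  rewrite big_seq psumr_eq0 => [/allP z|k /neg //].
  have : \sum_(1 <= k < 11) coord x k ^+ 2 = 0.
    rewrite big_seq big1 // => k hk; have := z k hk; rewrite hk oppr_eq0 => /eqP->.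
    by rewrite expr0n.
  by move=> s0; move: xx; rewrite lor_sum x0 s0.
have [i hi ri] := ex r br rr r0.
have [||j hj rj] := ex (- r) (balancedN br); rewrite ?coordN ?r0 ?lorNl ?lorNr ?opprK //.
rewrite coordN in rj.
have ij : i != j by apply/eqP => ij; move: ri rj; rewrite ij; lia.
(* The product of [r] with [dif int i j] is at most -2, so their difference has height 0 and
   nonnegative norm. *)
exists i, j; split => //; apply/eqP; rewrite -subr_eq0; apply/eqP; apply: height0_eq0.
  by rewrite coordD coordN coord_dif // r0; lia.
by rewrite lorBl !lorBr (lorC (dif _ _ _) r) rr (root_dif hi hj ij).2 lor_dif //; lia.
Qed.

(** From sum y = 3d and sum y^2 = d^2 + 2, the sum of the y_k^2 - y_k is (d - 1)(d - 2) = 0. Each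
    term is nonnegative, so every y_k is 0 or 1. *)
Lemma root_height12 (r : vec) : is_root r -> coord r 0 = 1 \/ coord r 0 = 2 ->
  exists2 s, idx s & r = ivec (coord r 0) s.
Proof.
move=> [br rr] h.
have /eqP : \sum_(1 <= k < 11) (coord r k ^+ 2 - coord r k) = 0.
  rewrite sumrB br; move: rr; rewrite lor_sum; move: (\sum_(_ <= _ < _) _) => A.
  by case: h => ->; rewrite expr2; lia.
rewrite psumr_eq0 => [/allP z|k _]; last by rewrite subr_ge0 int_le_sqr.
pose s := [seq k <- iota 1 10 | coord r k == 1].
exists s.
  by rewrite /idx filter_uniq ?iota_uniq //; apply/allP => k; rewrite mem_filter mem_iota => /andP[].
apply: coordP => k k11; rewrite coord_ivec //; case: eqP => [->//|/eqP]; rewrite -lt0n => k0.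
have := z k; rewrite mem_index_iota k0 k11 => /(_ isT) /= /eqP; rewrite expr2 => zk.
by rewrite mem_filter mem_iota k0 add1n k11 andbT; case: eqP => /= h1; nia.
Qed.

Lemma sum_ivec a s : idx s -> (size s : int) = \sum_(1 <= k < 11) coord (ivec a s) k.
Proof.
move=> hs; transitivity (\sum_(k <- s) (1 : int)).
  by rewrite big_const_seq count_predT iter_addr_0 natz.
rewrite -(sum_idx (fun=> 1) hs); apply: eq_big_nat => k /andP[k0 k1].
by rewrite coord_ivec // mul1r gtn_eqF.
Qed.

Lemma root_height1 (r : vec) : is_root r -> coord r 0 = 1 ->
  exists i j k, idx [:: i; j; k] /\ r = ivec 1 [:: i; j; k].
Proof.
move=> hr r0; have [s hs e] := root_height12 hr (or_introl r0).
rewrite r0 in e; have [br _] := hr.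
have s3 : size s = 3%N.
  have := br; rewrite e /balanced coord_ivec //= -sum_ivec //; lia.
by move: s hs e s3 => [|i [|j [|k []]]] // hs e _; exists i, j, k.
Qed.

Lemma root_ivec a s : idx s -> (size s)%:R = 3 * a -> (size s)%:R = a ^+ 2 + 2 ->
  is_root (ivec a s).
Proof.
move=> hs s1 s2; split; first exact: balanced_ivec.
rewrite lor_sum coord_ivec //=.
have -> : \sum_(1 <= k < 11) coord (ivec a s) k ^+ 2 = \sum_(1 <= k < 11) coord (ivec a s) k.
  apply: eq_big_nat => k /andP[k0 k1].
  by rewrite coord_ivec // gtn_eqF // expr2; case: (k \in s); rewrite ?mulr1 ?mulr0.
by rewrite -sum_ivec // -natz s2; ring.
Qed.

Section Positivity.
Variable S : vec -> Prop.
Hypothesis SD : forall x y, S x -> S y -> S (x + y).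

Lemma SMn n x : S x -> S (n.+1%:R *: x).
Proof.
move=> Sx; elim: n => [|n IH]; first by rewrite scale1r.
by rewrite -natr1 scalerDl scale1r; apply: SD.
Qed.

Lemma SDMn n x y : S x -> S y -> S (x + n%:R *: y).
Proof. by move=> Sx Sy; case: n => [|n]; rewrite ?scale0r ?addr0 //; apply/SD/SMn. Qed.

(* Subtracting from a root of height d > 0 the triples it meets negatively is a descent. *)
Lemma root_triples : (forall i j k, idx [:: i; j; k] -> S (ivec 1 [:: i; j; k])) ->
  forall r, is_root r -> 1 <= coord r 0 -> S r.
Proof.
move=> S3 r; move: {2}`|coord r 0|%N (leqnn `|coord r 0|) => n.
elim: n r => [|n IH] r rn hr r1; first by lia.
have [i [j [k [h3 neg]]]] := triple_neg hr.
set e := ivec 1 [:: i; j; k] in neg.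
have he : is_root e by apply: root_ivec.
have e0 : coord e 0 = 1 by rewrite coord_ivec.
have rE : r = refl e r + (`|lor r e|%N)%:R *: e.
  have -> : (`|lor r e|%N)%:R = - lor r e :> int by lia.
  by rewrite /refl scaleNr addrK.
have h0 : coord (refl e r) 0 = coord r 0 + lor r e by rewrite coordD coordZ e0 mulr1.
have [ge1|lt1] := lerP 1 (coord (refl e r) 0).
  rewrite rE; apply: SDMn; last exact: S3.
  by apply: IH => //; [lia|exact: root_refl].
(* Now -[lor r e] >= [coord r 0], and the bound leaves height 1, where [r] is itself a triple, or
   height 2 with product -2. The latter is impossible, since (2; s) and a triple pair to at least 2
   - 3. *)
have := gram_roots hr he; rewrite e0 mulr1 expr1n => g.
have [d1|d2] : coord r 0 = 1 \/ coord r 0 = 2 by nia.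
  by have [a [b [c [h3' ->]]]] := root_height1 hr d1; apply: S3.
have l2 : lor r e = -2 by nia.
have [s hs rs] := root_height12 hr (or_intror d2).
move: l2; rewrite rs d2 /e lor_ivec // coord_ivec // !big_cons big_nil.
have : all (fun k => 0 < k < 11)%N [:: i; j; k] by case/andP: h3.
rewrite /= => /and4P[/andP[i0 i1] /andP[j0 j1] /andP[k0 k1] _].
rewrite !coord_ivec // !gtn_eqF //; do 3 case: (_ \in s); lia.
Qed.
End Positivity.

(** The simple roots of E10, diagram T_{2,3,7}: the chain [al 1], ..., [al 9] with [al 0] attached
    to [al 3]. The balanced lattice is the orthogonal complement of the canonical class of the plane
    blown up in ten points. *)
Definition al (i : nat) : vec := if i is 0 then ivec 1 [:: 1; 2; 3]%N else dif int i.+1 i.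

Lemma ivec_perm a s s' : s =i s' -> ivec a s = ivec a s' :> vec.
Proof. by move=> ss; apply/rowP => i; rewrite !mxE ss. Qed.

Section Simple.
Variable S : vec -> Prop.
Hypothesis SD : forall x y, S x -> S y -> S (x + y).
Hypothesis Sal : forall i, (i < 10)%N -> S (al i).

Lemma S_dif i j : (0 < i)%N -> (i < j)%N -> (j < 11)%N -> S (dif int j i).
Proof.
move=> i0; elim: j => // j IH; rewrite ltnS leq_eqVlt => /orP[/eqP<-|ij] j11.
  by have := Sal j11; case: i i0 {IH j11} => [//|i] _; apply.
rewrite (_ : dif int j.+1 i = dif int j.+1 j + dif int j i).
  apply: SD; last by apply: IH => //; apply: ltnW.
  by have := Sal j11; case: j ij {IH j11} => [//|j] _; apply.
by apply: coordP => k k11; rewrite coordD !coord_dif //; lia.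
Qed.

Lemma S_addif x i j : S x -> (0 < i)%N -> (i <= j)%N -> (j < 11)%N -> S (x + dif int j i).
Proof.
move=> Sx i0; rewrite leq_eqVlt => /orP[/eqP<- _|ij j11]; last by apply: SD => //; apply: S_dif.
rewrite (_ : dif int i i = 0) ?addr0 //.
by apply: coordP => k k11; rewrite coord0 coord_dif // subrr.
Qed.

Lemma S_triple i j k : idx [:: i; j; k] -> S (ivec 1 [:: i; j; k]).
Proof.
move=> h; set s := sort leq [:: i; j; k].
have e : s =i [:: i; j; k] by move=> x; rewrite mem_sort.
rewrite -(ivec_perm 1 e).
have hs : idx s by move: h; rewrite /idx sort_uniq (eq_all_r e).
have : sorted ltn s by rewrite ltn_sorted_uniq_leq sort_sorted ?andbT; [case/andP: hs|exact: leq_total].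
have : size s = 3%N by rewrite size_sort.
case: s hs {e} => [|a [|b [|c []]]] // /andP[_ /= /and4P[ha hb hc _]] _ /and3P[ab bc _].
rewrite (_ : ivec _ _ = al 0 + dif int a 1 + dif int b 2 + dif int c 3).
  by do 3! [apply: S_addif; try lia]; apply: Sal.
apply: coordP => l l11; rewrite !coordD !coord_dif // !coord_ivec // !inE.
by case: (l =P 0%N) => [->|]; lia.
Qed.

(** Quantifying over all additively closed [S] spares the explicit coefficients of a root in the
    simple roots. Later uses take for [S] a lower bound on the product with [rho], joined with
    whatever is to be proved. *)
Lemma simple_dich r : is_root r -> S r \/ S (- r).
Proof.
move=> hr; have [r1|r1] := lerP 1 (coord r 0).
  by left; apply: (root_triples SD S_triple).
have [r2|r2] := lerP (coord r 0) (-1).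
  right; apply: (root_triples SD S_triple); last by rewrite coordN; lia.
  by case: hr => br rr; split; [exact: balancedN|rewrite lorNl lorNr opprK].
have r0 : coord r 0 = 0 by lia.
have [i [j [hi hj ij ->]]] := root_height0 hr r0.
have [lt|gt|eq] := ltngtP i j; last by rewrite eq eqxx in ij.
  right; rewrite (_ : - _ = dif int j i); first by apply: S_dif => //; lia.
  by apply: coordP => k k11; rewrite coordN !coord_dif //; lia.
by left; apply: S_dif => //; lia.
Qed.
End Simple.

(** * Reduction modulo 2 *)

Definition par (z : int) : bool := odd `|z|%N.

Lemma parD a b : par (a + b) = par a (+) par b.
Proof. rewrite /par; lia. Qed.
Lemma parN a : par (- a) = par a.
Proof. by rewrite /par abszN. Qed.
Lemma parM a b : par (a * b) = par a && par b.
Proof. by rewrite /par abszM oddM. Qed.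
Lemma par_bool (b : bool) : par b%:R = b.
Proof. by case: b. Qed.

(** Classes in L/2L are boolean lists, not vectors over a field of two elements, so that the finite
    checks reduce by computation. *)
Definition cl (x : vec) : seq bool := [seq par (coord x k) | k <- iota 0 11].

Fixpoint dotb (v w : seq bool) : bool :=
  match v, w with a :: v', b :: w' => (a && b) (+) dotb v' w' | _, _ => false end.
Fixpoint xors (v w : seq bool) : seq bool :=
  match v, w with a :: v', b :: w' => (a (+) b) :: xors v' w' | _, _ => [::] end.
(** The transvection that a reflection induces modulo 2. *)
Definition rcl (r x : seq bool) : seq bool := if dotb x r then xors x r else x.
Definition clvec (a : bool) (s : seq nat) : seq bool := a :: [seq k \in s | k <- iota 1 10].

Lemma dot_cl x y : dotb (cl x) (cl y) = par (lor x y).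
Proof.
rewrite /lor /index_iota /= !big_cons big_nil !(parD, parN, parM) /=.
by rewrite -[par 0]/false !addbF.
Qed.

Lemma xors_cl x y : xors (cl x) (cl y) = cl (x + y).
Proof. by rewrite /cl /= !coordD !parD. Qed.

Lemma clZ a x : cl (a *: x) = if par a then cl x else nseq 11 false.
Proof. by rewrite /cl /= !coordZ !parM; case: (par a). Qed.

Lemma cl_refl r x : cl (refl r x) = rcl (cl r) (cl x).
Proof.
rewrite /refl /rcl -xors_cl clZ dot_cl; case: (par _) => //.
by rewrite /cl /= !addbF.
Qed.

Lemma cl_ivec a s : cl (ivec a s) = clvec (par a) s.
Proof. by rewrite /cl /clvec /= !coord_ivec //= !par_bool. Qed.

Lemma cl_dif i j : cl (dif int i j) = [seq (k == i) (+) (k == j) | k <- iota 0 11].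
Proof. by rewrite /cl /= !coord_dif // !(parD, parN) !par_bool. Qed.

Definition clu i := clvec true (nth [::] nbr i).
Definition clv i := clvec false (nth [::] nonnbr i).

Lemma cl_ub i : cl (ub int i) = clu i. Proof. exact: cl_ivec. Qed.
Lemma cl_vb i : cl (vb int i) = clv i. Proof. exact: cl_ivec. Qed.

Lemma root_ub i : (i < 10)%N -> is_root (ub int i).
Proof. by move=> /nbrP[hs s3]; apply: root_ivec; rewrite ?s3. Qed.
Lemma root_vb i : (i < 10)%N -> is_root (vb int i).
Proof. by move=> /nonnbrP[hs s3]; apply: root_ivec; rewrite ?s3. Qed.

Lemma root_wall e : e \in walls20 -> is_root e.
Proof. by case/wall20P => i hi [] ->; [apply: root_ub|apply: root_vb]. Qed.

Lemma allP10 (P : nat -> bool) : all P (iota 0 10) -> forall i, (i < 10)%N -> P i.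
Proof. by move=> /allP h i hi; apply: h; rewrite mem_iota. Qed.

(* The two kinds of roots whose mirrors are walls of images of the chamber: modulo 2 they lie in
   the span V4 of the vb's, resp. in its orthogonal V6. *)
Definition typeV4 (r : vec) : Prop := exists2 a, (a < 10)%N & cl r = clv a.
Definition typeV6 (r : vec) : Prop := forall a, (a < 10)%N -> par (lor r (vb int a)) = false.

(** In fact [ub i] and [vb a] pair to 2 if i = a and to 0 otherwise. *)
Lemma ub_V6 i : (i < 10)%N -> typeV6 (ub int i).
Proof.
move=> hi a ha; rewrite -dot_cl cl_ub cl_vb.
have := @allP10 (fun i => all (fun a => ~~ dotb (clu i) (clv a)) (iota 0 10)).
by move=> /(_ isT i hi) /allP10 /(_ a ha) /negbTE.
Qed.

Lemma V4_even r i : typeV4 r -> (i < 10)%N -> par (lor r (ub int i)) = false.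
Proof.
move=> [a ha ra] hi; rewrite -dot_cl ra -cl_vb dot_cl lorC; exact: ub_V6.
Qed.

(** The ten classes [clv a] are the positive roots of A4, that is, the transpositions of S5, so a
    reflection in [vb i] permutes them. It acts trivially on V6 modulo 2, and a reflection in [ub i]
    acts trivially on V4. *)
Lemma refl_type e r : e \in walls20 -> typeV4 r \/ typeV6 r ->
  typeV4 (refl e r) \/ typeV6 (refl e r).
Proof.
move=> /wall20P[i hi [->|->]] [h4|h6].
- by left; case: (h4) => a ha ra; exists a => //; rewrite cl_refl -ra /rcl dot_cl V4_even.
- by right=> a ha; rewrite lorDl lorZl parD parM h6 // ub_V6 // andbF.
- left; case: h4 => a ha ra; rewrite /typeV4 cl_refl ra cl_vb.
  have := @allP10 (fun i => all (fun a => rcl (clv i) (clv a) \in [seq clv k | k <- iota 0 10]) (iota 0 10)).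
  move=> /(_ isT i hi) /allP10 /(_ a ha) /mapP[k]; rewrite mem_iota => hk ->; by exists k.
by right=> a ha; rewrite lorDl lorZl parD parM !h6.
Qed.

(** The base of the height induction, and the reason for the two types: a root of height 0 has its
    mirror through h, inside [D_Y]. It is a difference of two unit vectors, whose class is neither
    in V4 nor orthogonal to V4. *)
Lemma no_height0 r : is_root r -> typeV4 r \/ typeV6 r -> coord r 0 != 0.
Proof.
move=> hr ht; apply/eqP => /(root_height0 hr)[i [j [hi hj ij re]]]; move: ht; rewrite re.
case=> [[a ha]|h6].
  rewrite cl_dif; apply/eqP; move: a ha; apply: allP10.
  have := @allP10 (fun i => all (fun j => (i == j) ||
    all (fun a => [seq (k == i.+1) (+) (k == j.+1) | k <- iota 0 11] != clv a) (iota 0 10)) (iota 0 10)).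
  have hi' : (i.-1 < 10)%N by lia.
  have hj' : (j.-1 < 10)%N by lia.
  move=> /(_ isT i.-1 hi') /allP10 /(_ j.-1 hj'); rewrite !prednK; [|lia..].
  by case/orP=> // /eqP; lia.
have := @allP10 (fun i => all (fun j => (i == j) ||
  has (fun a => dotb [seq (k == i.+1) (+) (k == j.+1) | k <- iota 0 11] (clv a)) (iota 0 10)) (iota 0 10)).
have hi' : (i.-1 < 10)%N by lia.
have hj' : (j.-1 < 10)%N by lia.
move=> /(_ isT i.-1 hi') /allP10 /(_ j.-1 hj'); rewrite !prednK; [|lia..].
case/orP=> [/eqP|/hasP[a]]; first by lia.
by rewrite mem_iota -cl_dif -cl_vb dot_cl => /h6->.
Qed.

Lemma no_height1 r : is_root r -> typeV4 r -> coord r 0 != 1.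
Proof.
move=> hr [a ha ra]; apply/eqP => r0; move: ra; rewrite /cl /= r0 /clv /clvec.
by case.
Qed.

Lemma coord_wall e : e \in walls20 -> coord e 0 = 1 \/ coord e 0 = 2.
Proof. by case/wall20P => i hi [] ->; rewrite coord_ivec; auto. Qed.

Section Positivity.
Variable S : vec -> Prop.
Hypothesis SD : forall x y, S x -> S y -> S (x + y).
Hypothesis Sw : forall e, e \in walls20 -> S e.

Lemma root_pos r : is_root r -> typeV4 r \/ typeV6 r -> 0 <= coord r 0 -> S r.
Proof.
move: {2}`|coord r 0|%N (leqnn `|coord r 0|) => n.
elim: n r => [|n IH] r rn hr ht r0.
  by have := no_height0 hr ht; lia.
have [e ew neg] := wall_neg hr.
have he := root_wall ew; have he0 := coord_wall ew.
have rE : r = refl e r + (`|lor r e|%N)%:R *: e.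
  have -> : (`|lor r e|%N)%:R = - lor r e :> int by lia.
  by rewrite /refl scaleNr addrK.
have h0 : coord (refl e r) 0 = coord r 0 + lor r e * coord e 0 by rewrite coordD coordZ.
have [ge0|lt0] := lerP 0 (coord (refl e r) 0).
  rewrite rE; apply: SDMn => //; last exact: Sw.
  by apply: IH => //; [nia|exact: root_refl|exact: refl_type].
have rn0 := no_height0 hr ht.
have g := gram_roots hr he.
(* The jump below height 0 leaves two products. For -1, [e] is some [vb i] and [r] has height 1,
   which is odd, hence not over V4, while a root of V6 type pairs evenly with [vb i]. For -2,
   [r - e] is isotropic of height at most 2 in absolute value, so [r] is the wall itself. *)
have : lor r e = -1 \/ lor r e = -2 by case: he0 g h0 lt0 => ->; nia.
case=> re.
  exfalso; have [e0 r1] : coord e 0 = 2 /\ coord r 0 = 1.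
    by case: he0 h0 lt0 => ->; rewrite re; lia.
  case: ht => [h4|h6]; first by have := no_height1 hr h4; rewrite r1.
  move: ew e0 re => /wall20P[i hi [->|->]]; first by rewrite coord_ivec.
  by move=> _ re; have := h6 i hi; rewrite re.
have d0 : r - e = 0.
  apply: small_isotropic; first by case: hr he => [br _] [be _]; apply: balancedB.
    by case: hr he => [_ rr] [_ ee]; rewrite lorBl !lorBr rr ee (lorC e r) re.
  by rewrite coordD coordN; case: he0 h0 lt0 g => ->; rewrite re; lia.
by move/eqP: d0; rewrite subr_eq0 => /eqP->; apply: Sw.
Qed.
End Positivity.

(** * The Weyl vector and rigidity of the E10 chamber *)

Lemma lor_sqD (x y : vec) : lor (x + y) (x + y) = lor x x + 2 * lor y x + lor y y.
Proof. by rewrite lorDl !lorDr (lorC x y); ring. Qed.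

Definition vec_of (s : seq int) : vec := \row_i nth 0 s i.

Lemma coord_vec_of s k : (k < 11)%N -> coord (vec_of s) k = nth 0 s k.
Proof. by move=> hk; rewrite /coord mxE inordK. Qed.

Lemma lor_al0 (x : vec) : lor x (al 0) = coord x 0 - coord x 1 - coord x 2 - coord x 3.
Proof. by rewrite /al lor_ivec // !big_cons big_nil; ring. Qed.
Lemma lor_alS (x : vec) i : (i.+1 < 10)%N -> lor x (al i.+1) = coord x i.+1 - coord x i.+2.
Proof. by move=> hi; rewrite /al lor_dif //; lia. Qed.

Lemma root_al i : (i < 10)%N -> is_root (al i).
Proof. by case: i => [|i] hi; [apply: root_ivec|apply: root_dif; lia]. Qed.

Definition lor_als (s : seq int) (i : nat) : int :=
  if i is j.+1 then nth 0 s i - nth 0 s i.+1 else nth 0 s 0 - nth 0 s 1 - nth 0 s 2 - nth 0 s 3.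

Lemma lor_vec_of_al s i : (i < 10)%N -> lor (vec_of s) (al i) = lor_als s i.
Proof.
by case: i => [|i] hi; rewrite ?lor_al0 ?lor_alS // !coord_vec_of //; lia.
Qed.

Lemma al_nondeg (x : vec) : balanced x -> (forall i, (i < 10)%N -> lor x (al i) = 0) -> x = 0.
Proof.
move=> bx h; have step i : (i.+1 < 10)%N -> coord x i.+1 = coord x i.+2.
  by move=> hi; apply/eqP; rewrite -subr_eq0 -lor_alS // h.
have := h 0%N isT; rewrite lor_al0 -!step //.
have := bx; rewrite /balanced /index_iota /= !big_cons big_nil -!step // => e1 e2.
have x1 : coord x 1 = 0 by lia.
apply: coordP => -[|k] hk; rewrite coord0; first by lia.
by elim: k hk => // k IH hk; rewrite -step // IH //; lia.
Qed.

Lemma balanced_actB w x y : rword w -> balanced x -> balanced y -> balanced (act w x - y).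
Proof. by move=> hw bx by_; apply: balancedB => //; apply: balanced_act. Qed.

Definition rho : vec := vec_of [:: 115; 39; 38; 37; 36; 35; 34; 33; 32; 31; 30].

(** The coefficients of [rho] in the simple roots, equivalently its products with the fundamental
    weights. They are positive, which [act_rho] needs, and pairwise distinct, which rules out a
    permutation of the simple roots in [fundamental_rigid]. *)
Definition rho_coef : seq int := [:: 115; 76; 153; 231; 195; 160; 126; 93; 61; 30].

Lemma rho_al i : (i < 10)%N -> lor rho (al i) = 1.
Proof.
move=> hi; rewrite lor_vec_of_al //; apply/eqP; move: i hi.
exact: (@allP10 (fun i => lor_als _ i == 1)).
Qed.

Lemma rho_expand (x : vec) : balanced x ->
  lor x rho = \sum_(i <- iota 0 10) nth 0 rho_coef i * lor x (al i).
Proof.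
rewrite /= !big_cons big_nil lor_al0 !lor_alS //.
rewrite /balanced /lor /index_iota /= !big_cons !big_nil !coord_vec_of //= => bx; lia.
Qed.

Lemma balanced_rho : balanced rho.
Proof. by rewrite /balanced /index_iota /= !big_cons big_nil !coord_vec_of. Qed.

Lemma rho_norm : lor rho rho = 1240.
Proof.
by rewrite /lor /index_iota /= !big_cons big_nil !coord_vec_of.
Qed.

(** The fundamental weights, the basis dual to [al]; their integrality reflects the unimodularity of
    the lattice. *)
Definition omega : seq (seq int) :=
  [:: [:: 10; 3; 3; 3; 3; 3; 3; 3; 3; 3; 3]; [:: 7; 3; 2; 2; 2; 2; 2; 2; 2; 2; 2];
      [:: 14; 5; 5; 4; 4; 4; 4; 4; 4; 4; 4]; [:: 21; 7; 7; 7; 6; 6; 6; 6; 6; 6; 6];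
      [:: 18; 6; 6; 6; 6; 5; 5; 5; 5; 5; 5]; [:: 15; 5; 5; 5; 5; 5; 4; 4; 4; 4; 4];
      [:: 12; 4; 4; 4; 4; 4; 4; 3; 3; 3; 3]; [:: 9; 3; 3; 3; 3; 3; 3; 3; 2; 2; 2];
      [:: 6; 2; 2; 2; 2; 2; 2; 2; 2; 1; 1]; [:: 3; 1; 1; 1; 1; 1; 1; 1; 1; 1; 0]].

Definition om i : vec := vec_of (nth [::] omega i).

Lemma balanced_om i : (i < 10)%N -> balanced (om i).
Proof.
move=> hi; rewrite /balanced /index_iota /= !big_cons big_nil !coord_vec_of //.
apply/eqP; move: i hi.
by apply: (@allP10 (fun i => _ == 3 * nth 0 (nth [::] omega i) 0)).
Qed.

Lemma om_al i j : (i < 10)%N -> (j < 10)%N -> lor (om i) (al j) = (i == j)%:R.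
Proof.
move=> hi hj; rewrite lor_vec_of_al //; apply/eqP.
have := @allP10 (fun i => all (fun j => lor_als (nth [::] omega i) j == (i == j)%:R) (iota 0 10)).
by move=> /(_ isT i hi) /allP10 /(_ j hj).
Qed.

Lemma om_rho i : (i < 10)%N -> lor (om i) rho = nth 0 rho_coef i.
Proof.
move=> hi; rewrite rho_expand; last exact: balanced_om.
rewrite (bigD1_seq i) ?iota_uniq ?mem_iota // om_al // eqxx mulr1 big_seq_cond big1 => [|j]; first by rewrite /= addr0.
by case/andP; rewrite mem_iota => hj ji; rewrite om_al // eq_sym (negbTE ji) mulr0.
Qed.

Lemma al_inj i j : (i < 10)%N -> (j < 10)%N -> al i = al j -> i = j.
Proof.
move=> hi hj e; have := om_al hi hj; rewrite -e om_al // eqxx.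
by case: eqP.
Qed.

Lemma simple_cone (x : vec) : balanced x -> (forall i, (i < 10)%N -> 0 <= lor x (al i)) ->
  forall r, is_root r -> 0 < lor rho r -> 0 <= lor x r.
Proof.
move=> bx h r hr pr.
have [||[_ //]|[]] := simple_dich (S := fun l => 0 < lor rho l /\ 0 <= lor x l) _ _ hr.
- by move=> y z [? ?] [? ?]; rewrite !lorDr; lia.
- by move=> i hi; rewrite rho_al // h.
by rewrite lorNr; lia.
Qed.

(* The Weyl vector is the least lattice vector pairing strictly positively with all simple roots,
   so an isometry preserving the chamber fixes it. *)
Lemma act_rho w : rword w -> (forall i, (i < 10)%N -> 0 < lor (act w rho) (al i)) ->
  act w rho = rho.
Proof.
move=> hw pos; set d := act w rho - rho.
have bd : balanced d by apply: balanced_actB => //; exact: balanced_rho.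
have dal i : (i < 10)%N -> 0 <= lor d (al i).
  by move=> hi; have := pos i hi; rewrite lorBl rho_al //; lia.
(* [rho] is interior to the cone of the twenty walls, so [simple_cone] makes [d] nonnegative on them
   and [norm_ge0] applies. *)
have wpos e : e \in walls20 -> 0 < lor rho e.
  case/wall20P => i hi [] ->; rewrite lor_ivec ?coord_vec_of //=;
    try by [case: (nbrP hi)|case: (nonnbrP hi)]; rewrite subr_gt0; apply/idP; move: i hi.
    apply: (@allP10 (fun i => \sum_(k <- nth [::] nbr i) coord rho k < _)).
    by rewrite /= !big_cons !big_nil !coord_vec_of.
  apply: (@allP10 (fun i => \sum_(k <- nth [::] nonnbr i) coord rho k < _)).
  by rewrite /= !big_cons !big_nil !coord_vec_of.
have dd : 0 <= lor d d.
  by apply: norm_ge0 => // e ew; apply: simple_cone => //; [apply: root_wall|apply: wpos].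
have t i : i \in iota 0 10 -> 0 <= nth 0 rho_coef i * lor d (al i).
  rewrite mem_iota => hi; apply: mulr_ge0; last exact: dal.
  by apply/allP: (nth 0 rho_coef i) (mem_nth 0 (hi : (i < size rho_coef)%N)).
have dr : 0 <= lor d rho by rewrite rho_expand // big_seq; apply: sumr_ge0.
have : lor (rho + d) (rho + d) = lor rho rho by rewrite /d addrC subrK lor_act.
rewrite lor_sqD => nn.
(* Equality of norms reads 2 d.rho + d.d = 0 with both terms nonnegative. As [rho] has positive
   coefficients in the simple roots, [d] is orthogonal to each of them. *)
have /eqP : lor d rho = 0 by lia.
rewrite rho_expand // big_seq psumr_eq0 // => /allP z.
apply/eqP; rewrite -subr_eq0; apply/eqP; apply: al_nondeg => // i hi.
have hi' : i \in iota 0 10 by rewrite mem_iota.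
have := z i hi'; rewrite hi' /= mulf_eq0 => /orP[/eqP c0|/eqP //].
have : 0 < nth 0 rho_coef i.
  by apply/allP: (nth 0 rho_coef i) (mem_nth 0 (hi : (i < size rho_coef)%N)).
by rewrite c0.
Qed.

(** A sum of two positive roots pairs with [rho] to at least 2, so only the simple roots attain
    1. *)
Lemma rho_height1 r : is_root r -> lor rho r = 1 -> exists2 i, (i < 10)%N & r = al i.
Proof.
move=> hr r1.
have [||[|//]|[]] := simple_dich
  (S := fun l => 2 <= lor rho l \/ exists2 i, (i < 10)%N & l = al i) _ _ hr; rewrite ?r1 //.
- move=> x y hx hy; left; rewrite lorDr.
  have ge1 z : 2 <= lor rho z \/ (exists2 i, (i < 10)%N & z = al i) -> 1 <= lor rho z.
    by case=> [|[i hi ->]]; [lia|rewrite rho_al].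
  by have := ge1 x hx; have := ge1 y hy; lia.
- by move=> i hi; right; exists i.
- by rewrite lorNr r1.
by case=> i hi e; have := rho_al hi; rewrite -e lorNr r1.
Qed.

(** Fixing [rho], the word permutes the roots of product 1 with it, the simple roots, and hence the
    fundamental weights. The latter have distinct products with [rho], so the permutation is
    trivial. *)
Lemma fundamental_rigid w : rword w -> (forall i, (i < 10)%N -> 0 < lor (act w rho) (al i)) ->
  forall x, balanced x -> act w x = x.
Proof.
move=> hw /(act_rho hw) wrho.
have hw' := rword_rev hw.
have fixal i : (i < 10)%N -> act w (al i) = al i.
  move=> hi; have perm l : (l < 10)%N -> exists2 j, (j < 10)%N & act w (al l) = al j.
    move=> hl; apply: rho_height1; first by apply: root_act => //; apply: root_al.
    by rewrite -[X in lor X _]wrho lor_act // rho_al.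
  have [j hj wi] := perm i hi; suff ij : i = j by rewrite wi -ij.
  have e : act (rev w) (om j) = om i.
    apply/eqP; rewrite -subr_eq0; apply/eqP; apply: al_nondeg.
      by apply: balanced_actB => //; apply: balanced_om.
    move=> l hl; rewrite lorBl om_al // act_adj // revK.
    have [k hk wl] := perm l hl; rewrite wl om_al //.
    have -> : (j == k) = (i == l); last by rewrite subrr.
    apply/eqP/eqP => [jk|il].
      by apply: al_inj => //; rewrite -(actK (al i) hw) wi jk -wl actK.
    by apply: al_inj => //; rewrite -wl -wi il.
  have : nth 0 rho_coef j = nth 0 rho_coef i.
    by rewrite -!om_rho // -e act_adj // revK wrho.
  by move/eqP; rewrite nth_uniq // => /eqP.
move=> x bx; apply/eqP; rewrite -subr_eq0; apply/eqP; apply: al_nondeg.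
  by apply: balancedB => //; apply: balanced_act.
by move=> i hi; rewrite lorBl act_adj // -{1}(fixal i hi) actK // subrr.
Qed.

(** * Rigidity of the cone of the twenty walls *)

Definition hvec : vec := vec_of [:: 10; 3; 3; 3; 3; 3; 3; 3; 3; 3; 3].

Lemma balanced_h : balanced hvec.
Proof. by rewrite /balanced /index_iota /= !big_cons big_nil !coord_vec_of. Qed.

Lemma lor_h (x : vec) : balanced x -> lor x hvec = coord x 0.
Proof.
rewrite /balanced /lor /index_iota /= !big_cons !big_nil !coord_vec_of //= => bx; lia.
Qed.

Lemma h_ub (x : vec) : balanced x -> lor x hvec = \sum_(i <- iota 0 10) lor x (ub int i).
Proof.
rewrite /= !big_cons big_nil /ub /= !lor_ivec // !big_cons !big_nil /= => bx.
rewrite lor_h //; move: bx.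
by rewrite /balanced /index_iota /= !big_cons !big_nil => bx; lia.
Qed.

Lemma sum_vb (x : vec) : balanced x -> 2 * coord x 0 = \sum_(i <- iota 0 10) lor x (vb int i).
Proof.
rewrite /= !big_cons big_nil /vb /= !lor_ivec // !big_cons !big_nil /= => bx.
by move: bx; rewrite /balanced /index_iota /= !big_cons !big_nil => bx; lia.
Qed.

Lemma vb_nondeg (x : vec) : balanced x -> (forall i, (i < 10)%N -> lor x (vb int i) = 0) -> x = 0.
Proof.
move=> bx h; apply: height0_eq0.
  suff : 2 * coord x 0 = 0 by lia.
  by rewrite sum_vb // big_seq big1 // => i; rewrite mem_iota => /h.
suff -> : lor x x = 0 by [].
suff : 2 * lor x x = 0 by lia.
by rewrite lor_petersen // big_seq big1 // => i; rewrite mem_iota => /h->; rewrite mulr0.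
Qed.

Lemma cl_act_eq w x y : cl x = cl y -> cl (act w x) = cl (act w y).
Proof. by move=> e; elim: w => //= r w IH; rewrite !cl_refl IH. Qed.

Lemma cl_opp x : cl (- x) = cl x.
Proof. by rewrite -scaleN1r clZ. Qed.

(** By [root_pos] the inverse of [g] carries each wall to a root of positive height, and a root over
    V4 has even height, so no wall loses height. Hence g h - h lies in the cone of the walls; as g h
    and h have the same norm, it vanishes. *)
Lemma petersen_rigid g p : rword g ->
  (forall a, (a < 10)%N -> cl (act g (vb int a)) = cl (vb int a)) ->
  (forall e, e \in walls20 -> 0 < lor p e) ->
  (forall e, e \in walls20 -> 0 < lor (act g p) e) ->
  forall x, balanced x -> act g x = x.
Proof.
move=> hg clg hp hgp; have hg' := rword_rev hg.
have clg' a : (a < 10)%N -> cl (act (rev g) (vb int a)) = clv a.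
  by move=> ha; rewrite -(cl_act_eq (rev g) (clg a ha)) actK // cl_vb.
have ht e : e \in walls20 -> typeV4 (act (rev g) e) \/ typeV6 (act (rev g) e).
  move=> /wall20P[i hi [->|->]]; last by left; exists i => //; apply: clg'.
  right=> a ha; rewrite act_adj // revK -dot_cl clg // dot_cl; exact: ub_V6.
have hpos e : e \in walls20 -> 0 < coord (act (rev g) e) 0.
  move=> ew; rewrite ltNge; apply/negP => le0.
  have := @root_pos (fun l => 0 < lor p l) _ hp (- act (rev g) e).
  have [br rr] := root_act hg' (root_wall ew).
  have : 0 < lor p (act (rev g) e) by rewrite lorC act_adj // revK lorC hgp.
  move=> pos /(_ _ _ _ _)/wrap[].
  - by move=> x y; rewrite lorDr; apply: addr_gt0.
  - by split; [apply: balancedN|rewrite lorNl lorNr opprK].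
  - have [[a ha ca]|h6] := ht e ew; [left; exists a; rewrite ?cl_opp //|right=> a ha].
    by rewrite lorNl parN h6.
  - by rewrite coordN oppr_ge0.
  by rewrite lorNr oppr_gt0 => /(lt_trans pos); rewrite ltxx.
have hge e : e \in walls20 -> coord e 0 <= coord (act (rev g) e) 0.
  move=> ew; have := hpos e ew; move: (ew) => /wall20P[i hi [->|->]]; rewrite coord_ivec //=.
  have := no_height1 (root_act hg' (root_vb hi)) (ex_intro2 _ _ i hi (clg' i hi)); lia.
have gh : act g hvec = hvec.
  have bd : balanced (act g hvec - hvec).
    by apply: balanced_actB => //; apply: balanced_h.
  set d := act g hvec - hvec in bd *.
  have dw e : e \in walls20 -> 0 <= lor d e.
    move=> ew; have [be _] := root_wall ew; rewrite lorBl act_adj // !(lorC hvec) !lor_h //.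
      by rewrite subr_ge0 hge.
    exact: balanced_act.
  have dd := norm_ge0 bd dw.
  have d0 : 0 <= coord d 0.
    rewrite -lor_h // h_ub // big_seq; apply: sumr_ge0 => i; rewrite mem_iota => hi.
    by apply/dw/ub_wall.
  have : lor (hvec + d) (hvec + d) = lor hvec hvec by rewrite /d addrC subrK lor_act.
  rewrite lor_sqD (lor_h bd) => nn.
  by apply/eqP; rewrite -subr_eq0; apply/eqP; apply: height0_eq0 => //; rewrite -/d; lia.
(* A root of height 2 is (2; s), and its class modulo 2 determines s. *)
have gvb a : (a < 10)%N -> act g (vb int a) = vb int a.
  move=> ha; have hr := root_act hg (root_vb ha).
  have r2 : coord (act g (vb int a)) 0 = 2.
    by rewrite -lor_h; [rewrite -[X in lor _ X]gh lor_act // lor_h ?coord_ivec //; case: (root_vb ha)|case: hr].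
  have [s hs e] := root_height12 hr (or_intror r2).
  have := congr1 behead (clg a ha); rewrite e r2 !cl_ivec => /eq_in_map ss.
  apply: coordP => k hk; rewrite !coord_ivec //.
  by case: (posnP k) => // k0; rewrite ss ?mem_iota ?k0.
move=> x bx; apply/eqP; rewrite -subr_eq0; apply/eqP; apply: vb_nondeg.
  by apply: balancedB => //; apply: balanced_act.
by move=> a ha; rewrite lorBl act_adj // -{1}(gvb a ha) actK // subrr.
Qed.

(** * Words acting trivially on V4 *)

Definition actc (w : seq (seq bool)) (c : seq bool) := foldr rcl c w.

Lemma cl_act w x : cl (act w x) = actc [seq cl r | r <- w] (cl x).
Proof. by elim: w => //= r w IH; rewrite cl_refl IH. Qed.

(** The vertices {0,1}, {1,2}, {2,3}, {3,4} of the Petersen graph, the simple transpositions of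
    S5. *)
Definition chain : seq nat := [:: 0; 4; 7; 9]%N.

Lemma chain_lt k : k \in chain -> (k < 10)%N.
Proof. by move: k; apply/allP. Qed.

Definition stab (g : seq vec) : Prop :=
  rword g /\ forall k, k \in chain -> cl (act g (vb int k)) = clv k.

Lemma clD x y x' y' : cl x = cl x' -> cl y = cl y' -> cl (x + y) = cl (x' + y').
Proof. by move=> ex ey; rewrite -!xors_cl ex ey. Qed.

Lemma stab_all g : stab g -> forall a, (a < 10)%N -> cl (act g (vb int a)) = cl (vb int a).
Proof.
move=> [hg st] a ha.
(* Each vertex {i,j} is written as the run of simple transpositions from i to j, as a positive root
   of A4 is a sum of consecutive simple roots. *)
pose comb := [:: [:: 0]; [:: 0; 4]; [:: 0; 4; 7]; [:: 0; 4; 7; 9]; [:: 4]; [:: 4; 7];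
                 [:: 4; 7; 9]; [:: 7]; [:: 7; 9]; [:: 9]]%N.
pose S s : vec := \sum_(k <- s) vb int k.
have clS s : cl (S s) = foldr (fun k c => xors (clv k) c) (nseq 11 false) s.
  rewrite /S; elim: s => [|k s IH]; first by rewrite big_nil /cl /= !coord0.
  by rewrite big_cons -xors_cl IH cl_vb.
have e : cl (vb int a) = cl (S (nth [::] comb a)).
  rewrite clS cl_vb; apply/eqP; move: a ha.
  exact: (@allP10 (fun a => clv a == foldr _ _ (nth [::] comb a))).
rewrite (cl_act_eq g e) e.
have : all (mem chain) (nth [::] comb a) by move: a ha {e}; apply: (@allP10 (fun a => all _ _)).
rewrite /S; elim: (nth _ _ a) => [_|k s IH /andP[kc sc]].
  by rewrite big_nil -[X in act g X](scale0r 0) actZ !scale0r.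
by rewrite big_cons actD; apply: clD; rewrite ?IH // st // cl_vb.
Qed.

(** Entry a lists the vertices, numbered from 1, that are exchanged by the transposition given by
    the vertex a, itself numbered from 0. *)
Definition swaps : seq (seq (nat * nat)) :=
  [:: [:: (2, 5); (3, 6); (4, 7)]; [:: (1, 5); (3, 8); (4, 9)]; [:: (1, 6); (2, 8); (4, 10)];
      [:: (1, 7); (2, 9); (3, 10)]; [:: (1, 2); (6, 8); (7, 9)]; [:: (1, 3); (5, 8); (7, 10)];
      [:: (1, 4); (5, 9); (6, 10)]; [:: (2, 3); (5, 6); (9, 10)]; [:: (2, 4); (5, 7); (8, 10)];
      [:: (3, 4); (6, 7); (8, 9)]]%N.

(* Modulo 2 the reflection in vb a acts on V4 like the automorphism of the Petersen graph induced by
   a transposition; composing the two gives an isometry trivial on V4. *)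
Definition swap_word a : seq vec := [seq dif int p.1 p.2 | p <- nth [::] swaps a].

Lemma swap_wordP a r : (a < 10)%N -> r \in swap_word a -> is_root r /\ coord r 0 = 0.
Proof.
move=> ha /mapP[p hp ->].
have h : all (all (fun p => [&& (0 < p.1 < 11)%N, (0 < p.2 < 11)%N & p.1 != p.2])) swaps by [].
have /and3P[h1 h2 h3] := allP (all_nthP [::] h a ha) p hp.
split; first exact: root_dif.
by rewrite coord_dif //; lia.
Qed.

Lemma act_height0 w (x : vec) : (forall r, r \in w -> coord r 0 = 0) -> coord (act w x) 0 = coord x 0.
Proof.
elim: w => //= r w IH h; rewrite coordD coordZ (h r) ?inE ?eqxx // mulr0 addr0 IH // => s sw.
by rewrite h // inE sw orbT.
Qed.

(** The reflection in [ub i] is already trivial on V4. That in [vb i] is corrected by swaps along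
    roots of height 0, which leave every height unchanged and so keep the descent. *)
Lemma stab_descent (x : vec) e : e \in walls20 -> lor x e < 0 ->
  exists2 g, stab g & coord (act g x) 0 < coord x 0.
Proof.
move=> ew; have := coord_wall ew => e0 neg.
have lt : coord (refl e x) 0 < coord x 0 by rewrite coordD coordZ; case: e0 => ->; lia.
move: (ew) lt => /wall20P[i hi [->|->]] lt.
  exists [:: ub int i] => //; split.
    by move=> r; rewrite inE => /eqP->; apply: root_ub.
  by move=> k /chain_lt hk; rewrite cl_refl /rcl dot_cl lorC ub_V6 // cl_vb.
exists (swap_word i ++ [:: vb int i]); last first.
  by rewrite act_cat act_height0 // => r /(swap_wordP hi)[].
split.
  by move=> r; rewrite mem_cat inE => /orP[/(swap_wordP hi)[]//|/eqP->]; apply: root_vb.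
move=> k kc; rewrite cl_act map_cat -map_comp cl_vb /=.
rewrite (eq_map (g := fun p => [seq (k == p.1) (+) (k == p.2) | k <- iota 0 11])); last first.
  by move=> p /=; rewrite cl_dif.
rewrite cl_vb; apply/eqP; move: k kc; apply/allP; move: i hi {ew lt}.
pose sw i := [seq [seq (k == p.1) (+) (k == p.2) | k <- iota 0 11] | p <- nth [::] swaps i].
apply: (@allP10 (fun i => all (fun k => actc (sw i ++ [:: clv i]) (clv k) == clv k) chain)).
by vm_compute.
Qed.

(** * Root classes and quadruples of type A4 *)

Fixpoint bits (n : nat) : seq (seq bool) :=
  if n is n'.+1 then [seq false :: s | s <- bits n'] ++ [seq true :: s | s <- bits n'] else [:: [::]].

Lemma mem_bits s : s \in bits (size s).
Proof.
elim: s => // b s IH /=; rewrite mem_cat; apply/orP.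
by case: b; [right|left]; apply/mapP; exists s.
Qed.

(** Squares are 0 or 1 modulo 4, so sum y^2 = d^2 + 2 makes the number of odd y_k congruent to 2 or
    3, with the parity of d. These are the 45 + 120 + 210 + 120 + 1 = 496 vectors where the
    quadratic form x.x/2 on L/2L, of plus type, takes the value 1. *)
Definition rootcl : seq (seq bool) :=
  [seq odd (count id y) :: y | y <- bits 10 & (2 <= (count id y) %% 4)%N].

Lemma cl_root r : is_root r -> cl r \in rootcl.
Proof.
move=> [br rr]; set y := [seq par (coord r k) | k <- iota 1 10].
have sq (z : int) : exists m : int, z ^+ 2 = 4 * m + (par z : nat)%:R.
  have [q [->|->]] : exists q : int, z = 2 * q \/ z = 2 * q + 1.
      by exists (z %/ 2)%Z; lia.
    by exists (q * q); rewrite parM /= mulr0n; ring.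
  by exists (q * q + q); rewrite parD parM /= mulr1n; ring.
have [n [m nE]] : exists n : nat, exists2 m : int, count id y = n & n%:R = coord r 0 ^+ 2 + 2 + 4 * m.
  move: rr; rewrite lor_sum /index_iota /= !big_cons big_nil /y /=.
  have [m1 ->] := sq (coord r 1); have [m2 ->] := sq (coord r 2).
  have [m3 ->] := sq (coord r 3); have [m4 ->] := sq (coord r 4).
  have [m5 ->] := sq (coord r 5); have [m6 ->] := sq (coord r 6).
  have [m7 ->] := sq (coord r 7); have [m8 ->] := sq (coord r 8).
  have [m9 ->] := sq (coord r 9); have [m10 ->] := sq (coord r 10).
  move=> rr; eexists; exists (- (m1 + m2 + m3 + m4 + m5 + m6 + m7 + m8 + m9 + m10)); first by [].
  rewrite !natrD; lia.
have [m0 d2] := sq (coord r 0); rewrite d2 => nn.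
have n2 : odd n = par (coord r 0) by move: nn; case: (par _); lia.
apply/mapP; exists y.
  rewrite mem_filter nE mem_bits andbT.
  by move: nn; case: (par _); lia.
by rewrite nE n2.
Qed.

(** For 2, 3, 6, 7 or 10 odd coordinates the lifts are, up to order, (0; -1,1), (1; 1^3), (2; 1^6),
    (3; 2,1^7) and (4; 3,1^9). *)
Definition lift_root (c : seq bool) : seq int :=
  let y := behead c in
  let z := [seq (nat_of_bool b : int) | b <- y] in
  match count id y with
  | 2 => 0%R :: set_nth 0%R z (find id y) (-1)%R
  | 3 => 1%R :: z
  | 6 => 2%:R :: z
  | 7 => 3%:R :: set_nth 0%R z (find negb y) 2%:R
  | _ => 4%:R :: set_nth 0%R z 0 3%:R
  end.

Lemma lift_rootP c : c \in rootcl -> is_root (vec_of (lift_root c)) /\ cl (vec_of (lift_root c)) = c.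
Proof.
pose F (s : seq int) k := nth 0 s k.
(* The sums are spelled exactly as unfolding the big operators yields them, so that the computed
   equalities close the goals directly. *)
pose ok s c := [&& F s 1 + (F s 2 + (F s 3 + (F s 4 + (F s 5 + (F s 6 + (F s 7 + (F s 8
  + (F s 9 + (F s 10 + 0))))))))) == 3 * F s 0,
  F s 0 * F s 0 - (F s 1 * F s 1 + (F s 2 * F s 2 + (F s 3 * F s 3 + (F s 4 * F s 4
  + (F s 5 * F s 5 + (F s 6 * F s 6 + (F s 7 * F s 7 + (F s 8 * F s 8
  + (F s 9 * F s 9 + (F s 10 * F s 10 + 0)))))))))) == - 2 &
  [seq par (F s k) | k <- iota 0 11] == c].
have /allP h : all (fun c => ok (lift_root c) c) rootcl by vm_compute.
move=> /h /and3P[/eqP h1 /eqP h2 /eqP h3]; split; last by rewrite /cl /= !coord_vec_of.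
split; first by rewrite /balanced /index_iota /= !big_cons big_nil !coord_vec_of.
by rewrite /lor /index_iota /= !big_cons big_nil !coord_vec_of.
Qed.

(* The classes that can follow the first k vectors of the standard chain. The third vector has to be
   kept apart from the first, which has the same products with the first two. *)
Definition level (k : nat) : seq (seq bool) :=
  let v1 := clv 0 in let v2 := clv 4 in let v3 := clv 7 in
  match k with
  | 0 => rootcl
  | 1 => [seq c <- rootcl | dotb c v1]
  | 2 => [seq c <- rootcl | [&& ~~ dotb c v1, dotb c v2 & c != v1]]
  | _ => [seq c <- rootcl | [&& ~~ dotb c v1, ~~ dotb c v2 & dotb c v3]]
  end.

(* Transvections along b - v, or along c - v and then b - c, carrying the k-th vector v of the
   standard chain to b and fixing the previous ones. *)
Definition transvections (k : nat) (b : seq bool) : seq (seq bool) :=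
  let v := clv (nth 0%N chain k) in
  if b == v then [::] else if dotb b v then [:: xors b v] else
  let c := nth [::] (level k) (find (fun c => dotb c v && dotb c b) (level k)) in
  [:: xors b c; xors c v].

Definition tword k b : seq vec := [seq vec_of (lift_root c) | c <- transvections k b].

Lemma twordP k b : (k < 4)%N -> b \in level k ->
  [/\ rword (tword k b), cl (act (tword k b) (vb int (nth 0%N chain k))) = b &
    forall j, (j < k)%N -> cl (act (tword k b) (vb int (nth 0%N chain j))) = clv (nth 0%N chain j)].
Proof.
move=> hk hb.
pose ok k b := let t := transvections k b in
  [&& all (mem rootcl) t, actc t (clv (nth 0%N chain k)) == b &
    all (fun j => actc t (clv (nth 0%N chain j)) == clv (nth 0%N chain j)) (iota 0 k)].
have : ok k b.
  have /allP : all (ok k) (level k); last exact.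
  have /allP : all (fun k => all (ok k) (level k)) (iota 0 4) by vm_compute.
  by apply; rewrite mem_iota.
case/and3P => /allP h1 /eqP h2 /allP h3.
have e x : cl (act (tword k b) x) = actc (transvections k b) (cl x).
  rewrite cl_act -map_comp; congr (actc _ _); rewrite -[RHS]map_id.
  by apply/eq_in_map => c /h1 /lift_rootP[].
split; first by move=> r /mapP[c /h1 /lift_rootP[hr _] ->].
  by rewrite e cl_vb.
by move=> j hj; rewrite e cl_vb; apply/eqP/h3; rewrite mem_iota.
Qed.

Opaque rootcl.

Lemma cl_act_inj w x y : rword w -> cl (act w x) = cl (act w y) -> cl x = cl y.
Proof. by move=> hw /(cl_act_eq (rev w)); rewrite !actK. Qed.

Definition chainv (k : nat) : vec := vb int (nth 0%N chain k).

Lemma cl_chainv k : cl (chainv k) = clv (nth 0%N chain k).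
Proof. exact: cl_vb. Qed.

Lemma root_chainv k : (k < 4)%N -> is_root (chainv k).
Proof. by move=> hk; apply/root_vb/chain_lt/mem_nth. Qed.

Lemma stabP g : rword g -> (forall k, (k < 4)%N -> cl (act g (chainv k)) = cl (chainv k)) -> stab g.
Proof.
move=> hg h; split=> // a ac; have := h (index a chain).
by rewrite /chainv nth_index // cl_vb => ->; rewrite // -[4%N]/(size chain) index_mem.
Qed.

Lemma stab_chainv g k : stab g -> (k < 4)%N -> cl (act g (chainv k)) = cl (chainv k).
Proof. by move=> [_ h] hk; rewrite cl_chainv; apply/h/mem_nth. Qed.

Lemma stab_cat g g' : stab g -> stab g' -> stab (g ++ g').
Proof.
move=> sg sg'; case: (sg) (sg') => rg _ [rg' _]; apply: stabP; first exact: rword_cat.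
by move=> k hk; rewrite act_cat (cl_act_eq g (stab_chainv sg' hk)) stab_chainv.
Qed.

Lemma stab_rev g : stab g -> stab (rev g).
Proof.
move=> sg; case: (sg) => rg _; apply: stabP; first exact: rword_rev.
by move=> k hk; apply: (cl_act_inj rg); rewrite actKV // stab_chainv.
Qed.

Lemma stab_nil : stab [::].
Proof. by apply: stabP. Qed.

Opaque chainv.

Lemma level_mem k g : (k < 4)%N -> rword g ->
  (forall j, (j < k)%N -> cl (act g (chainv j)) = cl (chainv j)) ->
  cl (act g (chainv k)) \in level k.
Proof.
move=> hk hg fix_; have hr := cl_root (root_act hg (root_chainv hk)).
have d j : (j < k)%N -> dotb (cl (act g (chainv k))) (clv (nth 0%N chain j))
    = dotb (clv (nth 0%N chain k)) (clv (nth 0%N chain j)).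
  by move=> hj; rewrite -!cl_chainv -{1}(fix_ j hj) !dot_cl lor_act.
move: k hk fix_ hr d => [|[|[|[|k]]]] hk fix_ hr d; last by exfalso; clear -hk; move: hk.
- exact hr.
- have d0 : dotb (cl (act g (chainv 1))) (clv 0) = true := d 0%N isT.
  by rewrite /level mem_filter d0 hr.
- have d0 : dotb (cl (act g (chainv 2))) (clv 0) = false := d 0%N isT.
  have d1 : dotb (cl (act g (chainv 2))) (clv 4) = true := d 1%N isT.
  rewrite mem_filter; apply/andP; split; last exact hr.
  apply/and3P; split; [by rewrite d0|by rewrite d1|].
  apply/eqP => e; have e' : cl (act g (chainv 2)) = cl (act g (chainv 0)).
    exact: etrans e (esym (etrans (fix_ 0%N isT) (cl_chainv 0))).
  have := etrans (esym (cl_chainv 2)) (etrans (cl_act_inj hg e') (cl_chainv 0)).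
  by move/eqP; apply/negP; vm_compute.
have d0 : dotb (cl (act g (chainv 3))) (clv 0) = false := d 0%N isT.
have d1 : dotb (cl (act g (chainv 3))) (clv 4) = false := d 1%N isT.
have d2 : dotb (cl (act g (chainv 3))) (clv 7) = true := d 2%N isT.
rewrite mem_filter; apply/andP; split; last exact hr.
apply/and3P; split; [by rewrite d0|by rewrite d1|by rewrite d2].
Qed.

(** 120 classes have the products required of the third vector, and discarding the first vector
    leaves 119. The fourth needs no exclusion: a class in the span of v1, v2, v3 is orthogonal to v1
    + v3. *)
Lemma size_level : [/\ size (level 0) = 496, size (level 1) = 240, size (level 2) = 119
  & size (level 3) = 64]%N.
Proof. by vm_compute. Qed.

Lemma uniq_level k : (k < 4)%N -> uniq (level k).
Proof.
have u0 : uniq rootcl by vm_compute.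
by move: k => [|[|[|[|//]]]] _; rewrite /level ?filter_uniq.
Qed.

Opaque level tword.

Definition params := (seq bool * seq bool * seq bool * seq bool)%type.
Definition wf_params (b : params) : bool :=
  let: (b1, b2, b3, b4) := b in
  [&& b1 \in level 0, b2 \in level 1, b3 \in level 2 & b4 \in level 3].
Definition pword (b : params) : seq vec :=
  let: (b1, b2, b3, b4) := b in tword 0 b1 ++ tword 1 b2 ++ tword 2 b3 ++ tword 3 b4.

Lemma rword_pword b : wf_params b -> rword (pword b).
Proof.
case: b => [[[b1 b2] b3] b4] /and4P[h1 h2 h3 h4].
have [w1 _ _] := @twordP 0%N b1 isT h1; have [w2 _ _] := @twordP 1%N b2 isT h2.
have [w3 _ _] := @twordP 2%N b3 isT h3; have [w4 _ _] := @twordP 3%N b4 isT h4.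
by do !apply: rword_cat => //.
Qed.

(** Undoing the transvections of one level returns that vector to its standard class without
    disturbing the earlier ones; after four levels the remaining word fixes the whole chain. *)
Lemma params_surj g : rword g -> exists2 b, wf_params b &
  forall k, (k < 4)%N -> cl (act g (chainv k)) = cl (act (pword b) (chainv k)).
Proof.
have step k g' : (k < 4)%N -> rword g' ->
    (forall j, (j < k)%N -> cl (act g' (chainv j)) = cl (chainv j)) ->
    exists b g'', [/\ b \in level k, rword g'',
      forall x, cl (act g' x) = cl (act (tword k b) (act g'' x)) &
      forall j, (j < k.+1)%N -> cl (act g'' (chainv j)) = cl (chainv j)].
  move=> hk hg' fix_; have hb := level_mem hk hg' fix_.
  set b := cl _ in hb; have [hw wk wj] := twordP hk hb.
  have hw' := rword_rev hw.
  exists b, (rev (tword k b) ++ g'); split=> //; first exact: rword_cat.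
    by move=> x; rewrite act_cat actKV.
  move=> j; rewrite ltnS leq_eqVlt act_cat => /orP[/eqP->|hj]; apply: (cl_act_inj hw); rewrite actKV //.
  by rewrite fix_ // cl_chainv wj.
move=> hg; have [//|b1 [g1 [h1 hg1 e1 f1]]] := @step 0%N g isT hg _.
have [b2 [g2 [h2 hg2 e2 f2]]] := step 1%N g1 isT hg1 f1.
have [b3 [g3 [h3 hg3 e3 f3]]] := step 2%N g2 isT hg2 f2.
have [b4 [g4 [h4 hg4 e4 f4]]] := step 3%N g3 isT hg3 f3.
exists (b1, b2, b3, b4); first by rewrite /wf_params h1 h2 h3 h4.
move=> k hk; rewrite /pword !act_cat e1; apply: cl_act_eq; rewrite e2; apply: cl_act_eq.
by rewrite e3; apply: cl_act_eq; rewrite e4; apply: cl_act_eq; rewrite f4.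
Qed.

(** The words of later levels fix [chainv k] modulo 2, so its image depends on the first k + 1
    parameters only, and these are recovered one after the other. *)
Lemma params_inj b b' : wf_params b -> wf_params b' ->
  (forall k, (k < 4)%N -> cl (act (pword b) (chainv k)) = cl (act (pword b') (chainv k))) ->
  b = b'.
Proof.
have split_ k c c' v v' : (k < 4)%N -> c \in level k -> c' \in level k ->
    (forall j, (k <= j < 4)%N ->
      cl (act (tword k c ++ v) (chainv j)) = cl (act (tword k c' ++ v') (chainv j))) ->
    cl (act v (chainv k)) = cl (chainv k) -> cl (act v' (chainv k)) = cl (chainv k) ->
    c = c' /\ (forall j, (k.+1 <= j < 4)%N -> cl (act v (chainv j)) = cl (act v' (chainv j))).
  move=> hk hc hc' e f f'; have [hw wk _] := twordP hk hc; have [_ wk' _] := twordP hk hc'.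
  have cc : c = c'.
    have := e k; rewrite leqnn hk !act_cat (cl_act_eq _ f) (cl_act_eq _ f') wk wk'.
    by apply.
  split=> // j hj; subst c'; apply: (cl_act_inj hw).
  by rewrite -!act_cat e //; lia.
case: b => [[[b1 b2] b3] b4]; case: b' => [[[c1 c2] c3] c4].
move=> /and4P[h1 h2 h3 h4] /and4P[h1' h2' h3' h4'] e.
have fx k c j : (k < 4)%N -> c \in level k -> (j < k)%N -> cl (act (tword k c) (chainv j)) = cl (chainv j).
  by move=> hk hc hj; have [_ _ ->] := twordP hk hc; rewrite ?cl_chainv.
have fx4 b c j : b \in level 2 -> c \in level 3 -> (j < 2)%N ->
    cl (act (tword 2 b ++ tword 3 c) (chainv j)) = cl (chainv j).
  by move=> hb hc hj; rewrite act_cat (cl_act_eq _ (fx 3%N c j _ hc _)) ?(ltnW hj) ?fx // ltnW.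
have fx5 a b c j : a \in level 1 -> b \in level 2 -> c \in level 3 -> (j < 1)%N ->
    cl (act (tword 1 a ++ tword 2 b ++ tword 3 c) (chainv j)) = cl (chainv j).
  by move=> ha hb hc hj; rewrite act_cat (cl_act_eq _ (fx4 b c j hb hc _)) ?fx // ltnW.
have [c1E e1] := split_ 0%N b1 c1 (tword 1 b2 ++ tword 2 b3 ++ tword 3 b4)
  (tword 1 c2 ++ tword 2 c3 ++ tword 3 c4) isT h1 h1' e (fx5 _ _ _ 0%N h2 h3 h4 isT)
  (fx5 _ _ _ 0%N h2' h3' h4' isT).
have [c2E e2] := split_ 1%N b2 c2 (tword 2 b3 ++ tword 3 b4) (tword 2 c3 ++ tword 3 c4) isT h2 h2' e1
  (fx4 _ _ 1%N h3 h4 isT) (fx4 _ _ 1%N h3' h4' isT).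
have [c3E e3] := split_ 2%N b3 c3 (tword 3 b4) (tword 3 c4) isT h3 h3' e2
  (fx 3%N _ 2%N isT h4 isT) (fx 3%N _ 2%N isT h4' isT).
have [w4 k4 _] := @twordP 3%N b4 isT h4; have [_ k4' _] := @twordP 3%N c4 isT h4'.
have c4E : b4 = c4 by have := e3 3%N isT; rewrite k4 k4'.
by rewrite c1E c2E c3E c4E.
Qed.

(** * Images of the Weyl vector inside the cone *)

Lemma rho_regular g r : rword g -> is_root r -> lor (act g rho) r != 0.
Proof.
move=> hg hr; rewrite act_adj //.
have hr' : is_root (act (rev g) r) by apply: root_act => //; apply: rword_rev.
have : 0 < lor rho (act (rev g) r) \/ 0 < lor rho (- act (rev g) r).
  apply: (simple_dich (S := fun l => 0 < lor rho l)) hr' => [x y|i /rho_al -> //].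
  by rewrite lorDr; apply: addr_gt0.
by case=> h; [rewrite gt_eqF|rewrite lt_eqF // -oppr_gt0 -lorNr].
Qed.

Definition inD (x : vec) : Prop := forall e, e \in walls20 -> 0 < lor x e.

Lemma argmin_nat (T : Type) (P : T -> Prop) (f : T -> nat) :
  (exists x, P x) -> exists2 x, P x & forall y, P y -> (f x <= f y)%N.
Proof.
move=> [x0 Px0]; pose Q n := `[< exists2 x, P x & f x = n >].
have exQ : exists n, Q n by exists (f x0); apply/asboolP; exists x0.
case: (ex_minnP exQ) => n /asboolP[x Px fx] h; exists x => // y Py.
by rewrite fx; apply: h; apply/asboolP; exists y.
Qed.

Lemma coord_act_rho g : rword g -> 0 < coord (act g rho) 0.
Proof.
by move=> hg; apply: act_cone; rewrite ?rho_norm // coord_vec_of.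
Qed.

(** A translate of least height works: a wall negative on it would allow a further descent within
    [stab]. *)
Lemma reduce w : rword w -> exists2 g, stab g & inD (act (g ++ w) rho).
Proof.
move=> hw; have [|g sg gmin] := @argmin_nat _ stab (fun g => `|coord (act (g ++ w) rho) 0|%N).
  by exists [::]; apply: stab_nil.
have hgw : rword (g ++ w) by apply: rword_cat => //; case: sg.
exists g => // e ew; rewrite lt_def rho_regular //=; last exact: root_wall.
rewrite leNgt; apply/negP => /(stab_descent ew)[g' sg' lt].
have := gmin _ (stab_cat sg' sg); rewrite leqNgt => /negP; apply.
have hg' : rword (g' ++ g ++ w) by apply: rword_cat => //; case: sg'.
rewrite -act_cat in lt; have := coord_act_rho hgw; have := coord_act_rho hg'.
by rewrite -catA; lia.
Qed.

Lemma inD_unique g g' : rword g -> rword g' -> inD (act g rho) -> inD (act g' rho) ->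
  (forall k, (k < 4)%N -> cl (act (rev g) (chainv k)) = cl (act (rev g') (chainv k))) ->
  forall x, balanced x -> act g x = act g' x.
Proof.
move=> hg hg' dg dg' e x bx; have rg := rword_rev hg.
have h : rword (g' ++ rev g) by apply: rword_cat.
have st : stab (g' ++ rev g).
  by apply: stabP => // k hk; rewrite act_cat (cl_act_eq g' (e k hk)) actKV.
have fixp := petersen_rigid h (stab_all st) dg.
rewrite -[LHS](fixp _ (act g x)) ?act_cat ?actK //; last exact: balanced_act.
Qed.

Lemma chamber_unique g g' : rword g -> rword g' ->
  (forall i, (i < 10)%N -> 0 <= lor (act g rho) (act g' (al i))) ->
  forall x, balanced x -> act g x = act g' x.
Proof.
move=> hg hg' h x bx; have rg' := rword_rev hg'.
have hw : rword (rev g' ++ g) by apply: rword_cat.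
rewrite -[in RHS](@fundamental_rigid (rev g' ++ g) hw _ x bx) ?act_cat ?actKV // => i hi.
have := h i hi; rewrite le_eqVlt eq_sym (negbTE (rho_regular hg (root_act hg' (root_al hi)))) /=.
by move=> pos; rewrite act_adj // revK.
Qed.

(** * Chambers around real points *)

Section RealPoints.
Variable R : archiRealFieldType.
Implicit Types (y : 'rV[R]_11) (l : vec).

Definition toR l : 'rV[R]_11 := map_mx (fun z : int => z%:~R) l.
Definition pairR y l : R := lor y (toR l).

Lemma coord_toR l k : coord (toR l) k = (coord l k)%:~R.
Proof. by rewrite /coord mxE. Qed.

Lemma toRD l l' : toR (l + l') = toR l + toR l'.
Proof. by apply/rowP => i; rewrite !mxE rmorphD. Qed.
Lemma toRZ a l : toR (a *: l) = a%:~R *: toR l.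
Proof. by apply/rowP => i; rewrite !mxE rmorphM. Qed.
Lemma toRN l : toR (- l) = - toR l.
Proof. by apply/rowP => i; rewrite !mxE rmorphN. Qed.

Lemma pairRD y l l' : pairR y (l + l') = pairR y l + pairR y l'.
Proof. by rewrite /pairR toRD lorDr. Qed.
Lemma pairRZ y a l : pairR y (a *: l) = a%:~R * pairR y l.
Proof. by rewrite /pairR toRZ lorZr. Qed.
Lemma pairRN y l : pairR y (- l) = - pairR y l.
Proof. by rewrite /pairR toRN lorNr. Qed.

Lemma pair_toR l l' : pairR (toR l) l' = (lor l l')%:~R.
Proof.
rewrite /pairR /lor !coord_toR rmorphB rmorphM rmorph_sum; congr (_ - _).
by apply: eq_bigr => k _; rewrite !coord_toR rmorphM.
Qed.

Lemma balanced_toR l : balanced l -> balanced (toR l).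
Proof.
rewrite /balanced coord_toR => bl; transitivity ((\sum_(1 <= k < 11) coord l k)%:~R : R).
  by rewrite rmorph_sum; apply: eq_bigr => k _; rewrite coord_toR.
by rewrite bl rmorphM.
Qed.

Definition timelike y : Prop := [/\ balanced y, 0 < lor y y & 0 < coord y 0].

(* AM-GM with weight [coord l 0 / coord y 0]. *)
Lemma pairR_lower y l : timelike y -> 0 < lor l l -> 0 < coord l 0 ->
  (coord l 0)%:~R * (lor y y / (2 * coord y 0)) <= pairR y l.
Proof.
move=> [_ yy y0] ll l0; set D := coord y 0 in y0 *.
have d0 : 0 < (coord l 0)%:~R :> R by rewrite ltr0z.
set d := (coord l 0)%:~R in d0 *.
have le : \sum_(1 <= k < 11) coord y k * coord (toR l) k
    <= \sum_(1 <= k < 11) (coord y k ^+ 2 * (d / D) / 2 + coord (toR l) k ^+ 2 * (D / d) / 2).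
  apply: ler_sum => k _; rewrite -subr_ge0.
  set a := coord y k; set b := coord (toR l) k.
  have -> : a ^+ 2 * (d / D) / 2 + b ^+ 2 * (D / d) / 2 - a * b
      = (a * d - b * D) ^+ 2 / (2 * d * D) by field; rewrite !gt_eqF.
  by rewrite divr_ge0 ?sqr_ge0 // !mulr_ge0 // ltW.
have sp : \sum_(1 <= k < 11) coord (toR l) k ^+ 2 <= d ^+ 2.
  have : 0 <= lor (toR l) (toR l) by rewrite -/(pairR _ _) pair_toR ler0z ltW.
  by rewrite lor_sum coord_toR subr_ge0.
move: le; rewrite big_split /= -!mulr_suml => le.
rewrite /pairR {2}/lor coord_toR -/D -/d lerBrDr -lerBrDl; apply: (le_trans le).
have dD : 0 <= D / d / 2 by rewrite !divr_ge0 // ltW.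
have := ler_wpM2r dD sp; rewrite lor_sum -/D.
set A := \sum_(1 <= i < 11) _; set B := \sum_(1 <= i < 11) _.
move=> h.
have -> : D * d - d * ((D ^+ 2 - B) / (2 * D)) = B * (d / D) / 2 + d ^+ 2 * (D / d / 2).
  by field; rewrite !gt_eqF.
by rewrite lerD2l -[_ / 2]mulrA.
Qed.

Lemma box_argmin (S : vec -> Prop) (f : vec -> R) (N : nat) : (exists x, S x) ->
  (forall x, S x -> forall k, (k < 11)%N -> (`|coord x k| <= N)%N) ->
  exists2 m, S m & forall x, S x -> f m <= f x.
Proof.
move=> [x0 Sx0] bd.
pose dec (t : {ffun 'I_11 -> 'I_(N + N).+1}) : vec := \row_i ((t i : nat)%:Z - N%:Z).
have enc x : S x -> exists t, dec t = x.
  move=> Sx; exists [ffun i => inord `|x 0 i + N%:Z|]; apply/rowP => i; rewrite mxE ffunE.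
  have := bd x Sx i (ltn_ord i); rewrite /coord inord_val => xi.
  by move: (x 0 i) xi => z zN; rewrite inordK; lia.
have [t0 e0] := enc x0 Sx0.
have P0 : `[< S (dec t0) >] by apply/asboolP; rewrite e0.
have [t /asboolP St tmin] := @arg_minP _ R _ t0 (fun t => `[< S (dec t) >]) (fun t => f (dec t)) P0.
exists (dec t) => // x Sx; have [u eu] := enc x Sx; rewrite -eu; apply: tmin.
by apply/asboolP; rewrite eu.
Qed.

Lemma coord_le l k : (k < 11)%N -> 0 < lor l l -> (`|coord l k| <= `|coord l 0|)%N.
Proof.
move=> hk; rewrite lor_sum subr_gt0; case: (posnP k) => [->//|k0] lt.
have : coord l k ^+ 2 <= \sum_(1 <= j < 11) coord l j ^+ 2.
  rewrite (bigD1_seq k) ?iota_uniq ?mem_index_iota ?k0 //=.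
  by rewrite lerDl; apply: sumr_ge0 => j _; apply: sqr_ge0.
move=> /le_lt_trans /(_ lt); rewrite !expr2; nia.
Qed.

(** Local finiteness of the chambers in disguise: [pairR_lower] bounds the height, hence all
    coordinates, of the orbit vectors doing no worse than [rho], and a box holds finitely many
    integral vectors. *)
Lemma orbit_argmin y : timelike y -> exists2 g, rword g &
  forall g', rword g' -> pairR y (act g rho) <= pairR y (act g' rho).
Proof.
move=> ty; have [_ yy y0] := ty.
set c := lor y y / (2 * coord y 0).
have c0 : 0 < c by rewrite divr_gt0 // mulr_gt0.
pose S l := exists g, [/\ rword g, act g rho = l & pairR y l <= pairR y rho].
have nilw : rword [::] by [].
have Sb x : S x -> forall k, (k < 11)%N -> (`|coord x k| <= Num.bound (pairR y rho / c))%N.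
  move=> [g [hg <- le]] k hk.
  have ll : 0 < lor (act g rho) (act g rho) by rewrite lor_act // rho_norm.
  have l0 := coord_act_rho hg; apply: (leq_trans (coord_le hk ll)).
  have h := le_trans (pairR_lower ty ll l0) le.
  have p0 : 0 <= pairR y rho.
    apply: le_trans h; apply: mulr_ge0; last exact: ltW.
    by rewrite ler0z ltW.
  have : (coord (act g rho) 0)%:~R < (Num.bound (pairR y rho / c))%:R :> R.
    apply: le_lt_trans (archi_boundP _); last by rewrite divr_ge0 // ltW.
    by rewrite ler_pdivlMr.
  rewrite [in X in _ < X]pmulrn ltr_int; lia.
have [|_ [g [hg <- _]] gmin] := @box_argmin S (pairR y) _ _ Sb.
  by exists rho, [::].
exists g => // g' hg'.
have [le|lt] := lerP (pairR y (act g' rho)) (pairR y rho).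
  by apply: gmin; exists g'.
by apply: (le_trans _ (ltW lt)); apply: (gmin rho); exists [::].
Qed.

(** Since [rho] and [al i] pair to 1, passing to the chamber across the i-th mirror adds
    [act g (al i)] to the orbit vector. *)
Lemma chamber_min y g : rword g ->
  (forall g', rword g' -> pairR y (act g rho) <= pairR y (act g' rho)) ->
  forall i, (i < 10)%N -> 0 <= pairR y (act g (al i)).
Proof.
move=> hg gmin i hi; have hw : rword (g ++ [:: al i]).
  by apply: rword_cat => // r; rewrite inE => /eqP->; apply: root_al.
have := gmin _ hw; rewrite act_cat /= /refl rho_al // scale1r actD pairRD.
by rewrite lerDl.
Qed.

Lemma chamber_ex y : timelike y -> exists2 g, rword g &
  forall i, (i < 10)%N -> 0 <= pairR y (act g (al i)).
Proof. by move=> ty; have [g hg gmin] := orbit_argmin ty; exists g => //; apply: chamber_min. Qed.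

Lemma rootN r : is_root r -> is_root (- r).
Proof. by move=> [br rr]; split; [apply: balancedN|rewrite lorNl lorNr opprK]. Qed.

Lemma chamber_root y g r : rword g -> (forall i, (i < 10)%N -> 0 <= pairR y (act g (al i))) ->
  is_root r -> 0 < lor (act g rho) r -> 0 <= pairR y r.
Proof.
move=> hg ya hr pos; have hg' := rword_rev hg.
have hr' : is_root (act (rev g) r) by apply: root_act.
have pos' : 0 < lor rho (act (rev g) r) by rewrite -act_adj.
have : (0 < lor rho (act (rev g) r) /\ 0 <= pairR y (act g (act (rev g) r)))
    \/ (0 < lor rho (- act (rev g) r) /\ 0 <= pairR y (act g (- act (rev g) r))).
  apply: (simple_dich (S := fun l => 0 < lor rho l /\ 0 <= pairR y (act g l))) hr'.
    move=> a b [a1 a2] [b1 b2]; rewrite lorDr actD pairRD.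
    by split; [apply: addr_gt0|apply: addr_ge0].
  by move=> i hi; rewrite rho_al // ya.
case=> [[_]|[p _]]; first by rewrite actKV.
by move: p; rewrite lorNr oppr_gt0 => /(lt_trans pos'); rewrite ltxx.
Qed.

(* Minimising [pairR y] first and the height second over the images of the Weyl vector yields a
   chamber around [y] inside the cone cut out by any walls not separating [y] from [hvec]. *)
Lemma chamber_around y : timelike y -> (forall e, e \in walls20 -> 0 <= pairR y e) ->
  exists g, [/\ rword g, forall i, (i < 10)%N -> 0 <= pairR y (act g (al i)) & inD (act g rho)].
Proof.
move=> ty yw; have [g0 hg0 min0] := orbit_argmin ty.
pose P g := rword g /\ pairR y (act g rho) = pairR y (act g0 rho).
have [|g [hg eg] gmin] := @argmin_nat _ P (fun g => `|coord (act g rho) 0|%N).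
  by exists g0.
have al_ge0 : forall i, (i < 10)%N -> 0 <= pairR y (act g (al i)).
  by apply: chamber_min => // g' hg'; rewrite eg; apply: min0.
exists g; split=> // e ew; have he := root_wall ew.
rewrite lt_def rho_regular //= leNgt; apply/negP => neg.
have ye : pairR y e <= 0.
  rewrite -oppr_ge0 -pairRN; apply: (chamber_root hg al_ge0); first exact: rootN.
  by rewrite lorNr oppr_gt0.
have y0 : pairR y e = 0 by apply: le_anti; rewrite ye yw.
have hw : rword (e :: g) by apply/rword_cons.
have := gmin (e :: g); rewrite /P /= /refl pairRD pairRZ y0 mulr0 addr0 => /(_ (conj hw eg)).
rewrite coordD coordZ; have := coord_act_rho hg; have := coord_act_rho hw.
by rewrite /= /refl coordD coordZ; case: (coord_wall ew) => ->; lia.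
Qed.

End RealPoints.

(** * The generators of S_X *)

Definition pairs5 : seq (seq nat) :=
  [:: [:: 0; 1]; [:: 0; 2]; [:: 0; 3]; [:: 0; 4]; [:: 1; 2];
      [:: 1; 3]; [:: 1; 4]; [:: 2; 3]; [:: 2; 4]; [:: 3; 4]]%N.

(* The i-th node corresponds to the complement of the i-th pair, so that the Enriques involution
   exchanges the generators with the same index. *)
Definition bset (i : nat) : {set 'I_5} := finset (fun x : 'I_5 => val x \in nth [::] pairs5 i).
Definition aset (i : nat) : {set 'I_5} := ~: bset i.

Lemma card_bset i : (i < 10)%N -> #|bset i| = 2%N.
Proof.
move=> hi; rewrite -sum1_card (eq_bigl (fun x : 'I_5 => val x \in nth [::] pairs5 i)); last first.
  by move=> x; rewrite inE.
rewrite big_mkcond -(big_mkord xpredT (fun x => if x \in nth [::] pairs5 i then 1 else 0)%N).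
rewrite /index_iota /= !big_cons big_nil; apply/eqP; move: i hi.
by apply: (@allP10 (fun i => _ == 2%N)).
Qed.

Lemma card_aset i : (i < 10)%N -> #|aset i| = 3%N.
Proof. by move=> hi; apply/eqP; rewrite -(eqn_add2l #|bset i|) /aset cardsC card_ord card_bset. Qed.

Definition aidx (i : 'I_10) : Aidx :=
  exist (fun s : {set 'I_5} => #|s| == 3%N) (aset i) (introT eqP (card_aset (ltn_ord i))).
Definition bidx (i : 'I_10) : Bidx :=
  exist (fun s : {set 'I_5} => #|s| == 2%N) (bset i) (introT eqP (card_bset (ltn_ord i))).

Lemma bset_inj i j : (i < 10)%N -> (j < 10)%N -> bset i = bset j -> i = j.
Proof.
move=> hi hj e; apply/eqP.
have := @allP10 (fun i => all (fun j => all (fun x =>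
  (x \in nth [::] pairs5 i) == (x \in nth [::] pairs5 j)) (iota 0 5) ==> (i == j)) (iota 0 10)).
move=> /(_ isT i hi) /allP10 /(_ j hj) /implyP; apply; apply/allP => x; rewrite mem_iota => hx.
by have := congr1 (fun s : {set 'I_5} => Ordinal hx \in s) e; rewrite !inE => /eqP.
Qed.

Lemma bidx_inj : injective bidx.
Proof. by move=> i j /(congr1 val) /= /bset_inj e; apply/val_inj/e; apply: ltn_ord. Qed.

Lemma aidx_inj : injective aidx.
Proof.
by move=> i j /(congr1 val) /= /finset.setC_inj /bset_inj e; apply/val_inj/e; apply: ltn_ord.
Qed.

Lemma aidx_bij : bijective aidx.
Proof.
apply: inj_card_bij; first exact: aidx_inj.
by rewrite card_sig card_ord -cardsE card_draws card_ord.
Qed.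

Lemma bidx_bij : bijective bidx.
Proof.
apply: inj_card_bij; first exact: bidx_inj.
by rewrite card_sig card_ord -cardsE card_draws card_ord.
Qed.

Lemma bset_sub i j : (i < 10)%N -> (j < 10)%N ->
  (bset j \subset aset i) = (j.+1 \in nth [::] nbr i).
Proof.
move=> hi hj; have := @allP10 (fun i => all (fun j => (all (fun x =>
  (x \in nth [::] pairs5 j) ==> (x \notin nth [::] pairs5 i)) (iota 0 5)) ==
   (j.+1 \in nth [::] nbr i)) (iota 0 10)).
move=> /(_ isT i hi) /allP10 /(_ j hj) /eqP <-.
apply/fintype.subsetP/allP => [h x|h x].
  rewrite mem_iota => hx; have := h (Ordinal hx); rewrite !inE => h'.
  exact/implyP.
by rewrite !inE => hx; apply: (implyP (h _ _)) hx; rewrite mem_iota /= ltn_ord.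
Qed.

(** * The chart of invariant classes *)

Section Chart.
Variable R : realType.
Implicit Types c d : Gen -> R.

Definition cE c (k : nat) : R := c (inl (aidx (inord k))).
Definition cL c (k : nat) : R := c (inr (bidx (inord k))).

Lemma sum_Gen (F : Gen -> R) : \sum_(g : Gen) F g = \sum_(i <- iota 0 10) (cE F i + cL F i).
Proof.
rewrite -[iota 0 10]/(index_iota 0 10) big_split !big_mkord big_sumType.
congr (_ + _).
  rewrite (reindex aidx); last exact/onW_bij/aidx_bij.
  by apply: eq_bigr => i _; rewrite /cE inord_val.
rewrite (reindex bidx); last exact/onW_bij/bidx_bij.
by apply: eq_bigr => i _; rewrite /cL inord_val.
Qed.

Definition gramE d (i : nat) : R := - 2 * cE d i + \sum_(k <- nth [::] nbr i) cL d k.-1.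
Definition gramL d (i : nat) : R := - 2 * cL d i + \sum_(k <- nth [::] nbr i) cE d k.-1.

Lemma sum_delta (F : nat -> R) i : (i < 10)%N ->
  \sum_(j <- iota 0 10) (if i == j then -2 : int else 0)%:~R * F j = -2 * F i.
Proof.
move=> hi; rewrite (bigD1_seq i) ?iota_uniq ?mem_iota // eqxx big1 => [|j ji].
  by rewrite /= addr0 mulrNz.
by rewrite eq_sym (negbTE ji) mul0r.
Qed.

Lemma sum_nbr (F : nat -> R) i : (i < 10)%N ->
  \sum_(j <- iota 0 10) (if j.+1 \in nth [::] nbr i then 1 : int else 0)%:~R * F j
  = \sum_(k <- nth [::] nbr i) F k.-1.
Proof.
move=> hi; have [hs _] := nbrP hi.
rewrite -(sum_idx (fun k => F k.-1) hs) -[iota 0 10]/(index_iota 0 10) big_add1 /=.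
by apply: eq_bigr => j _; case: (_ \in _); rewrite ?mulr1 ?mulr0 ?mul1r ?mul0r.
Qed.

Lemma nbr_lt (i k : nat) : (i < 10)%N -> k \in nth [::] nbr i -> (k.-1 < 10)%N.
Proof. by move=> hi ki; have [/andP[_ /allP /(_ k ki) /andP[]] _] := nbrP hi; lia. Qed.

Lemma nbr_sym i j : (i < 10)%N -> (j < 10)%N ->
  (j.+1 \in nth [::] nbr i) = (i.+1 \in nth [::] nbr j).
Proof.
move=> hi hj; have := @allP10 (fun i => all (fun j => (j.+1 \in nth [::] nbr i) ==
  (i.+1 \in nth [::] nbr j)) (iota 0 10)).
by move=> /(_ isT i hi) /allP10 /(_ j hj) /eqP.
Qed.

Lemma sum_gramE d i : (i < 10)%N ->
  \sum_(h : Gen) (gram (inl (aidx (inord i))) h)%:~R * d h = gramE d i.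
Proof.
move=> hi; rewrite sum_Gen big_split /gramE -(sum_delta (cE d) hi) -(sum_nbr (cL d) hi).
congr (_ + _); rewrite !big_seq; apply: eq_bigr => j; rewrite mem_iota => hj; congr (_ * _).
  by rewrite /cE /gram (inj_eq aidx_inj) -val_eqE /= !inordK.
by rewrite /cL /gram /= !inordK // bset_sub.
Qed.

Lemma sum_gramL d i : (i < 10)%N ->
  \sum_(h : Gen) (gram (inr (bidx (inord i))) h)%:~R * d h = gramL d i.
Proof.
move=> hi; rewrite sum_Gen big_split [LHS]addrC /gramL -(sum_delta (cL d) hi) -(sum_nbr (cE d) hi).
congr (_ + _); rewrite !big_seq; apply: eq_bigr => j; rewrite mem_iota => hj; congr (_ * _).
  by rewrite /cL /gram (inj_eq bidx_inj) -val_eqE /= !inordK.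
by rewrite /cE /gram /= !inordK // bset_sub // nbr_sym.
Qed.

Lemma bX_gram c d :
  bX c d = \sum_(i <- iota 0 10) (cE c i * gramE d i + cL c i * gramL d i).
Proof.
rewrite /bX sum_Gen !big_seq; apply: eq_bigr => i; rewrite mem_iota => hi.
rewrite -sum_gramE // -sum_gramL // !mulr_sumr.
by congr (_ + _); apply: eq_bigr => h _; rewrite mulrA.
Qed.

Lemma eps_inl_inr i j : (i < 10)%N -> (j < 10)%N ->
  epsrel (inl (aidx (inord i))) (inr (bidx (inord j))) = (i == j).
Proof.
move=> hi hj; rewrite /= !inordK // /aset finset.setCK.
by apply/eqP/eqP => [/bset_inj ->|->].
Qed.

Lemma eps_inr_inl i j : (i < 10)%N -> (j < 10)%N ->
  epsrel (inr (bidx (inord i))) (inl (aidx (inord j))) = (i == j).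
Proof.
move=> hi hj; rewrite /= !inordK // /aset (inj_eq (@finset.setC_inj _)).
by apply/eqP/eqP => [/bset_inj ->|->].
Qed.

Lemma sum_one (F : nat -> R) i : (i < 10)%N ->
  \sum_(j <- iota 0 10) (if j == i then F j else 0) = F i.
Proof.
move=> hi; rewrite (bigD1_seq i) ?iota_uniq ?mem_iota // eqxx big1 => [|j /negbTE -> //].
by rewrite /= addr0.
Qed.

Lemma cE_eps c i : (i < 10)%N -> cE (epsX c) i = cL c i.
Proof.
move=> hi; rewrite /cE /epsX sum_Gen -[RHS](sum_one (cL c) hi) !big_seq.
apply: eq_bigr => j; rewrite mem_iota => hj; rewrite /cE /cL eps_inr_inl //.
by rewrite [epsrel _ _]/= add0r.
Qed.

Lemma cL_eps c i : (i < 10)%N -> cL (epsX c) i = cE c i.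
Proof.
move=> hi; rewrite /cL /epsX sum_Gen -[RHS](sum_one (cE c) hi) !big_seq.
apply: eq_bigr => j; rewrite mem_iota => hj; rewrite /cE /cL eps_inl_inr //.
by rewrite [epsrel (inr _) _]/= addr0.
Qed.

Lemma numeqP c d : numeq c d <-> forall i, (i < 10)%N ->
  gramE c i = gramE d i /\ gramL c i = gramL d i.
Proof.
have gE i : (i < 10)%N -> gramE (fun g => c g - d g) i = gramE c i - gramE d i.
  by move=> hi; rewrite /gramE /cE /cL sumrB; ring.
have gL i : (i < 10)%N -> gramL (fun g => c g - d g) i = gramL c i - gramL d i.
  by move=> hi; rewrite /gramL /cE /cL sumrB; ring.
split=> [h i hi|h g].
  have := h (inl (aidx (inord i))); have := h (inr (bidx (inord i))).
  rewrite (sum_gramE (fun g => c g - d g)) // (sum_gramL (fun g => c g - d g)) // gE // gL //.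
  by move=> /eqP + /eqP; rewrite !subr_eq0 => /eqP -> /eqP ->.
case: g => [x|x].
  have [f fK Kf] := aidx_bij; have := ltn_ord (f x) => hi.
  rewrite -(Kf x) -(inord_val (f x)) (sum_gramE (fun g => c g - d g)) // gE //.
  by case: (h _ hi) => -> _; rewrite subrr.
have [f fK Kf] := bidx_bij; have := ltn_ord (f x) => hi.
rewrite -(Kf x) -(inord_val (f x)) (sum_gramL (fun g => c g - d g)) // gL //.
by case: (h _ hi) => _ ->; rewrite subrr.
Qed.

(* On classes invariant under the involution only the half-sums matter: with A the adjacency matrix
   of the Petersen graph and s the half-sums, the form of S_Y is s.(A - 2)s, which becomes
   d^2 - y.y for d = sum s and y = A s. *)
Definition half_sum c (i : nat) : R := (cE c i + cL c i) / 2.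

Definition chart c : 'rV[R]_11 := \row_k
  if val k == 0%N then \sum_(i <- iota 0 10) half_sum c i
  else \sum_(j <- nth [::] nbr (val k).-1) half_sum c j.-1.

Lemma coord_chart0 c : coord (chart c) 0 = \sum_(i <- iota 0 10) half_sum c i.
Proof. by rewrite /coord mxE /= inordK. Qed.
Lemma coord_chartS c k : (k < 10)%N ->
  coord (chart c) k.+1 = \sum_(j <- nth [::] nbr k) half_sum c j.-1.
Proof. by move=> hk; rewrite /coord mxE /= inordK. Qed.

Lemma balanced_chart c : balanced (chart c).
Proof.
rewrite /balanced /index_iota /= !big_cons big_nil !coord_chartS // coord_chart0.
by rewrite /= !big_cons !big_nil; ring.
Qed.

Lemma forall10 (P : nat -> Prop) : P 0%N -> P 1%N -> P 2%N -> P 3%N -> P 4%N -> P 5%N -> P 6%N ->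
  P 7%N -> P 8%N -> P 9%N -> forall i, (i < 10)%N -> P i.
Proof. by move=> p0 p1 p2 p3 p4 p5 p6 p7 p8 p9; do 10 case=> //. Qed.

Lemma chart_ub c i : (i < 10)%N ->
  lor (chart c) (ub R i) = - 2 * half_sum c i + \sum_(j <- nth [::] nbr i) half_sum c j.-1.
Proof.
move: i; apply: forall10; rewrite /ub lor_ivec // /= !big_cons !big_nil !coord_chartS // coord_chart0;
  by rewrite /= !big_cons !big_nil; ring.
Qed.

Lemma chart_vb c i : (i < 10)%N -> lor (chart c) (vb R i) = 2 * half_sum c i.
Proof.
move: i; apply: forall10; rewrite /vb lor_ivec // /= !big_cons !big_nil !coord_chartS // coord_chart0;
  by rewrite /= !big_cons !big_nil; ring.
Qed.

Definition eps_inv c := numeq (epsX c) c.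

(** The antisymmetric part t of an invariant class satisfies A t = -2 t. It need not vanish, as -2
    is an eigenvalue of multiplicity four: this is where the twenty generators of the rank 16
    lattice S_X have their relations. *)
Lemma eps_inv_diff c i : eps_inv c -> (i < 10)%N ->
  \sum_(j <- nth [::] nbr i) (cE c j.-1 - cL c j.-1) = - 2 * (cE c i - cL c i).
Proof.
move=> /numeqP h hi; have [+ _] := h i hi; rewrite /gramE cE_eps //.
have -> : \sum_(k <- nth [::] nbr i) cL (epsX c) k.-1 = \sum_(k <- nth [::] nbr i) cE c k.-1.
  rewrite !big_seq; apply: eq_bigr => k ki; by rewrite cL_eps // (nbr_lt hi ki).
by rewrite sumrB => e; lra.
Qed.

Lemma gram_eps_inv d i : eps_inv d -> (i < 10)%N ->
  gramE d i = lor (chart d) (ub R i) /\ gramL d i = lor (chart d) (ub R i).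
Proof.
move=> hd hi; have := eps_inv_diff hd hi; rewrite chart_ub // /gramE /gramL.
have -> : \sum_(j <- nth [::] nbr i) half_sum d j.-1 =
  (\sum_(j <- nth [::] nbr i) cE d j.-1 + \sum_(j <- nth [::] nbr i) cL d j.-1) / 2.
  by rewrite -big_split /= mulr_suml.
by rewrite sumrB /half_sum; split; lra.
Qed.

(** An invariant [d] has equal products with E_i and L_i, so only the half-sums of [c] enter; the
    rest is A^2 + A - 2 = J. *)
Lemma bY_chart c d : eps_inv d -> bY c d = lor (chart c) (chart d).
Proof.
move=> hd; rewrite /bY bX_gram.
transitivity (\sum_(i <- iota 0 10) half_sum c i * lor (chart d) (ub R i)).
  rewrite mulr_suml !big_seq; apply: eq_bigr => i; rewrite mem_iota => hi.
  by have [-> ->] := gram_eps_inv hd hi; rewrite /half_sum; field.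
rewrite (eq_big_seq (fun i => half_sum c i * (- 2 * half_sum d i + \sum_(j <- nth [::] nbr i) half_sum d j.-1))).
  rewrite /lor /index_iota /= !big_cons !big_nil !coord_chartS // !coord_chart0.
  by rewrite /= !big_cons !big_nil; ring.
by move=> i; rewrite mem_iota => hi; rewrite chart_ub.
Qed.

(** Equal products give (A - 2)s = (A - 2)s' for the half-sums, and 2 is not an eigenvalue of A. *)
Lemma chart_numeq c d : numeq c d -> chart c = chart d.
Proof.
move=> /numeqP h.
have e i : (i < 10)%N -> -2 * half_sum c i + \sum_(j <- nth [::] nbr i) half_sum c j.-1
    = -2 * half_sum d i + \sum_(j <- nth [::] nbr i) half_sum d j.-1.
  move=> hi; have [] := h i hi; rewrite /gramE /gramL /half_sum -!mulr_suml !big_split /=; lra.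
have hcd : forall i, (i < 10)%N -> half_sum c i = half_sum d i.
  move: (e 0%N isT) (e 1%N isT) (e 2%N isT) (e 3%N isT) (e 4%N isT) (e 5%N isT) (e 6%N isT)
    (e 7%N isT) (e 8%N isT) (e 9%N isT).
  rewrite /= !big_cons !big_nil /= => e0 e1 e2 e3 e4 e5 e6 e7 e8 e9.
  by apply: (@forall10 (fun i => half_sum c i = half_sum d i)); lra.
apply: coordP => -[|k] hk; first by rewrite !coord_chart0; apply: eq_big_seq => i; rewrite mem_iota => /hcd.
rewrite !coord_chartS //; apply: eq_big_seq => j jk; apply: hcd.
exact: (@nbr_lt k).
Qed.

End Chart.

Lemma toR_ivec (R : archiRealFieldType) a s : toR R (ivec a s) = ivec a%:~R s.
Proof. by apply/rowP => i; rewrite !mxE; case: ifP => // _; rewrite rmorph_nat. Qed.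

Lemma forall_aidx (P : Aidx -> Prop) :
  (forall i, (i < 10)%N -> P (aidx (inord i))) -> forall a, P a.
Proof.
have [f fK Kf] := aidx_bij => h a; rewrite -(Kf a) -(inord_val (f a)).
by apply: h; apply: ltn_ord.
Qed.

Section Generators.
Variable R : realType.
Implicit Types c d : Gen -> R.

Lemma vpair_chart c i : (i < 10)%N ->
  vpair (aidx (inord i)) c = lor (chart c) (vb R i).
Proof.
move=> hi; rewrite chart_vb // /vpair sum_Gen.
transitivity (cE c i + cL c i); last by rewrite /half_sum; field.
rewrite -(sum_one (fun j => cE c j + cL c j) hi); apply: eq_big_seq => j; rewrite mem_iota => hj.
rewrite /cE /cL /vval eps_inl_inr // (eq_sym i j).
have -> : (inl (aidx (inord j)) == inl (aidx (inord i)) :> Gen) = (j == i).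
  by rewrite -[LHS]/(aidx _ == aidx _) (inj_eq aidx_inj) -val_eqE /= !inordK.
rewrite [epsrel _ _]/= orbF -[inr _ == inl _]/false /=.
by case: eqP => _; rewrite ?mulr1 ?mulr0 ?addr0.
Qed.

Lemma eps_invP c : (forall i, (i < 10)%N ->
    \sum_(j <- nth [::] nbr i) (cE c j.-1 - cL c j.-1) = - 2 * (cE c i - cL c i)) ->
  eps_inv c.
Proof.
move=> h; apply/numeqP => i hi; rewrite /gramE /gramL cE_eps // cL_eps //.
have e1 : \sum_(k <- nth [::] nbr i) cL (epsX c) k.-1 = \sum_(k <- nth [::] nbr i) cE c k.-1.
  by apply: eq_big_seq => k ki; rewrite cL_eps // (nbr_lt hi ki).
have e2 : \sum_(k <- nth [::] nbr i) cE (epsX c) k.-1 = \sum_(k <- nth [::] nbr i) cL c k.-1.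
  by apply: eq_big_seq => k ki; rewrite cE_eps // (nbr_lt hi ki).
by have := h i hi; rewrite e1 e2 sumrB; split; lra.
Qed.

Lemma eps_inv_sym c : (forall i, (i < 10)%N -> cE c i = cL c i) -> eps_inv c.
Proof.
move=> h; apply: eps_invP => i hi; rewrite (h i) // subrr mulr0 big_seq big1 // => j ji.
by rewrite h ?subrr // (nbr_lt hi ji).
Qed.

Lemma chart_half c (f : nat -> R) : (forall i, (i < 10)%N -> half_sum c i = f i) ->
  chart c = \row_k (if val k == 0%N then \sum_(i <- iota 0 10) f i
                    else \sum_(j <- nth [::] nbr (val k).-1) f j.-1).
Proof.
move=> h; apply/rowP => k; rewrite !mxE; case: eqP => k0.
  by apply: eq_big_seq => i; rewrite mem_iota => /h.
apply: eq_big_seq => j; have hk : ((val k).-1 < 10)%N by have := ltn_ord k; rewrite /=; lia.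
by move=> /(nbr_lt hk) /h.
Qed.

Lemma sum_pred1 (i : nat) s : uniq s -> \sum_(j <- s) (j == i)%:R = (i \in s)%:R :> R.
Proof.
elim: s => [|x s IH] /=; first by rewrite big_nil.
move=> /andP[xs us]; rewrite big_cons IH // inE eq_sym.
by case: (i =P x) xs => [<- /negbTE ->|_ _]; rewrite ?addr0 ?add0r.
Qed.

Lemma bY_ubar c i : (i < 10)%N ->
  bY c (pi_ubar R (aidx (inord i))) = lor (chart c) (ub R i).
Proof.
move=> hi.
have hE j : (j < 10)%N -> cE (pi_ubar R (aidx (inord i))) j = (j == i)%:R.
  move=> hj; rewrite /cE /pi_ubar.
  rewrite -[inl _ == inl _]/(aidx _ == aidx _) (inj_eq aidx_inj) -val_eqE /= !inordK // orbF.
  by case: eqP.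
have hL j : (j < 10)%N -> cL (pi_ubar R (aidx (inord i))) j = (j == i)%:R.
  move=> hj; rewrite /cL /pi_ubar eps_inl_inr // (eq_sym i j).
  by rewrite -[inr _ == inl _ :> Gen]/false /=; case: eqP.
rewrite bY_chart; last by apply: eps_inv_sym => j hj; rewrite hE // hL.
congr (lor _ _); rewrite (chart_half (f := fun j => (j == i)%:R)); last first.
  by move=> j hj; rewrite /half_sum hE // hL //; field.
apply: coordP => k hk; rewrite /ub coord_ivec // /coord mxE /= inordK //.
case: k hk => [|k] hk /=; first by rewrite -[X in \sum_(_ <- X) _]/(iota 0 10) sum_pred1 ?iota_uniq // mem_iota hi.
have -> : \sum_(j <- nth [::] nbr k) (j.-1 == i)%:R = \sum_(j <- nth [::] nbr k) (j == i.+1)%:R :> R.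
  apply: eq_big_seq => j jk; have [/andP[_ /allP /(_ j jk) /andP[j0 _]] _] := @nbrP k hk.
  by congr (_ : bool)%:R; lia.
have us : uniq (nth [::] nbr k) by case: (@nbrP k hk) => /andP[].
rewrite nbr_sym // sum_pred1 //.
Qed.

Lemma bY_sum_ubar c : bY c (pi_sum_ubar R) = coord (chart c) 0.
Proof.
rewrite bY_chart; last by apply: eps_inv_sym.
rewrite (@chart_half (pi_sum_ubar R) (fun=> 1)); last first.
  by move=> i _; rewrite /half_sum /cE /cL /pi_sum_ubar; field.
set h := \row_k _; have h0 : coord h 0 = 10.
  by rewrite /coord mxE /= inordK // !big_cons big_nil; ring.
have hS k : (0 < k < 11)%N -> coord h k = 3.
  case: k => [//|k] hk; rewrite /coord mxE /= inordK //= big_const_seq count_predT iter_addr_0.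
  by have [_ ->] := @nbrP k hk; rewrite mulr0n || ring.
have := balanced_chart c; rewrite /balanced /lor h0.
under [X in _ - X = _]eq_big_nat => k hk do rewrite hS //.
by rewrite -mulr_suml => ->; ring.
Qed.

End Generators.

(* Coefficients on the E's, resp. L's, of integral divisor classes representing the fundamental
   weights [om k]; only their half-sums are determined by [om k]. *)
Definition repE : seq (seq int) :=
  [:: [:: 1; 1; 1; 1; 1; 1; 1; 1; 1; 1]; [:: 1; 0; 0; 0; 1; 1; 1; 1; 1; 1];
      [:: 1; 2; 1; 1; 1; 1; 1; 2; 2; 2]; [:: 1; 2; 2; 1; 2; 2; 2; 3; 3; 3];
      [:: 1; 1; 2; 2; 1; 2; 2; 2; 2; 3]; [:: 1; 1; 1; 2; 2; 1; 2; 1; 2; 2];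
      [:: 0; 1; 1; 2; 1; 1; 1; 1; 2; 2]; [:: 0; 1; 1; 1; 1; 1; 1; 1; 1; 1];
      [:: 0; 0; 1; 1; 0; 1; 1; 1; 0; 1]; [:: 0; 0; 0; 1; 0; 0; 1; 0; 1; 0]].
Definition repL : seq (seq int) :=
  [:: [:: 1; 1; 1; 1; 1; 1; 1; 1; 1; 1]; [:: 1; 1; 1; 1; 0; 0; 0; 1; 1; 1];
      [:: 2; 1; 1; 1; 1; 2; 2; 1; 1; 2]; [:: 3; 2; 2; 2; 2; 2; 3; 1; 2; 2];
      [:: 2; 2; 1; 1; 3; 2; 2; 2; 2; 1]; [:: 1; 1; 2; 1; 2; 2; 1; 2; 1; 2];
      [:: 1; 1; 1; 1; 2; 2; 1; 1; 1; 1]; [:: 0; 1; 1; 1; 1; 1; 1; 1; 1; 1];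
      [:: 0; 1; 0; 1; 1; 0; 1; 1; 1; 0]; [:: 0; 0; 1; 0; 0; 1; 0; 1; 0; 0]].

Lemma lor_suml (K : comNzRingType) (I : Type) (s : seq I) (f : I -> 'rV[K]_11) y :
  lor (\sum_(i <- s) f i) y = \sum_(i <- s) lor (f i) y.
Proof. by elim: s => [|i s IH]; rewrite ?big_nil ?lor0l // !big_cons lorDl IH. Qed.

Lemma gen_fun (u w : nat -> int) : exists c : Gen -> int, forall i, (i < 10)%N ->
  c (inl (aidx (inord i))) = u i /\ c (inr (bidx (inord i))) = w i.
Proof.
have [f fK _] := aidx_bij; have [f' fK' _] := bidx_bij.
exists (fun g => match g with inl a => u (f a) | inr b => w (f' b) end) => i hi.
by rewrite fK fK' inordK.
Qed.

Section Representatives.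
Variable R : realType.

Lemma sum_foldr (f : nat -> int) s :
  \sum_(j <- s) (f j)%:~R = (foldr (fun j a => f j + a) 0 s)%:~R :> R.
Proof. by elim: s => [|j s IH]; rewrite ?big_nil // big_cons IH -rmorphD. Qed.

(** The half-sums need not be integers. The chosen classes are invariant because [repE] minus [repL]
    is, in each row, in the kernel of A + 2. *)
Lemma om_rep k : (k < 10)%N -> exists2 c : Gen -> int,
  eps_inv (fun g => (c g)%:~R : R) & chart (fun g => (c g)%:~R : R) = toR R (om k).
Proof.
move=> hk; set U := nth 0 (nth [::] repE k); set W := nth 0 (nth [::] repL k).
have [c hc] := gen_fun U W; exists c.
  apply: eps_invP => i hi.
  rewrite (eq_big_seq (fun j => (U j.-1 - W j.-1)%:~R)); last first.
    by move=> j ji; have [] := hc _ (nbr_lt hi ji); rewrite /cE /cL => -> ->; rewrite rmorphB.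
  rewrite (sum_foldr (fun j => U j.-1 - W j.-1)).
  have [] := hc i hi; rewrite /cE /cL => -> ->; rewrite -rmorphB.
  have -> : - 2 = (-2 : int)%:~R :> R by rewrite rmorphN.
  rewrite -rmorphM; congr (_%:~R); apply/eqP; rewrite /U /W; move: i hi; apply: allP10.
  move: k hk {U W c hc}; apply: (@allP10 (fun k => all _ (iota 0 10))).
  by vm_compute.
have hh i : (i < 10)%N -> half_sum (fun g => (c g)%:~R : R) i = (U i + W i)%:~R / 2.
  by move=> hi; have [] := hc i hi; rewrite /half_sum /cE /cL => -> ->; rewrite rmorphD.
have two (a b : int) : a = 2 * b -> a%:~R / 2 = b%:~R :> R.
  by move=> ->; rewrite rmorphM /=; field.
apply: coordP => -[|i] hi; rewrite coord_toR coord_vec_of //.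
  rewrite coord_chart0 (eq_big_seq (fun i => (U i + W i)%:~R / 2)); last first.
    by move=> i; rewrite mem_iota => /hh.
  rewrite -mulr_suml (sum_foldr (fun j => U j + W j)); apply: two; apply/eqP.
  rewrite /U /W; move: k hk {U W c hc hh}; apply: allP10; by vm_compute.
rewrite ltnS in hi; rewrite coord_chartS // (eq_big_seq (fun j => (U j.-1 + W j.-1)%:~R / 2)); last first.
  by move=> j ji; rewrite hh // (nbr_lt _ ji).
rewrite -mulr_suml (sum_foldr (fun j => U j.-1 + W j.-1)); apply: two; apply/eqP.
rewrite /U /W; move: i hi; apply: allP10.
move: k hk {U W c hc hh}; apply: (@allP10 (fun k => all _ (iota 0 10))).
by vm_compute.
Qed.

Lemma pair_al0 (y : 'rV[R]_11) : pairR y (al 0) = coord y 0 - coord y 1 - coord y 2 - coord y 3.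
Proof. by rewrite /pairR toR_ivec lor_ivec // !big_cons big_nil; ring. Qed.
Lemma pair_alS (y : 'rV[R]_11) i : (i.+1 < 10)%N ->
  pairR y (al i.+1) = coord y i.+1 - coord y i.+2.
Proof.
move=> hi; have -> : pairR y (al i.+1) = lor y (dif R i.+2 i.+1).
  by rewrite /pairR; congr (lor _ _); apply/rowP => j; rewrite !mxE rmorphB !rmorph_nat.
by rewrite lor_dif //; lia.
Qed.

Lemma pair_al_nondeg (x : 'rV[R]_11) : balanced x ->
  (forall i, (i < 10)%N -> pairR x (al i) = 0) -> x = 0.
Proof.
move=> bx h; have step i : (i.+1 < 10)%N -> coord x i.+1 = coord x i.+2.
  by move=> hi; apply/eqP; rewrite -subr_eq0 -pair_alS // h.
have := h 0%N isT; rewrite pair_al0 -!step //.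
have := bx; rewrite /balanced /index_iota /= !big_cons big_nil -!step // => e1 e2.
have x1 : coord x 1 = 0 by lra.
apply: coordP => -[|k] hk; rewrite coord0; first by lra.
by elim: k hk => // k IH hk; rewrite -step // IH //; lia.
Qed.

Lemma balanced_sum (I : eqType) (s : seq I) (f : I -> 'rV[R]_11) :
  (forall i, i \in s -> balanced (f i)) -> balanced (\sum_(i <- s) f i).
Proof.
move=> h; rewrite big_seq; apply: (big_ind (fun x => balanced x)) => //; last exact: balancedD.
by rewrite -(scale0r 0); apply: balancedZ; rewrite /balanced big1 ?coord0 ?mulr0 // => i _; rewrite coord0.
Qed.

Lemma om_expand (x : 'rV[R]_11) : balanced x ->
  x = \sum_(k <- iota 0 10) pairR x (al k) *: toR R (om k).
Proof.
move=> bx; apply/eqP; rewrite -subr_eq0; apply/eqP; apply: pair_al_nondeg.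
  apply: balancedB => //; apply: balanced_sum => k; rewrite mem_iota => hk.
  by apply/balancedZ/balanced_toR/balanced_om.
move=> i hi; rewrite /pairR lorBl lor_suml.
rewrite (eq_big_seq (fun k => if k == i then pairR x (al k) else 0)).
  by rewrite (sum_one (fun k => pairR x (al k)) hi) subrr.
move=> k; rewrite mem_iota => hk; rewrite lorZl -[lor (toR _ _) _]/(pairR _ _) pair_toR om_al //.
by case: eqP => _; rewrite ?mulr1 ?mulr0.
Qed.

End Representatives.

(** * Comparison of an isometric copy of S_Y with the balanced lattice *)

Section Lattice.
Variables (R : realType) (M : 'M[int]_10) (psi : 'I_10 -> Gen -> int).
Hypothesis iso : isometry_to_SY R M psi.
Implicit Types x y : 'rV[R]_10.

Definition xi x : 'rV[R]_11 := chart (psiR psi x).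
Definition psii (i : 'I_10) : Gen -> R := fun g => (psi i g)%:~R.

Lemma xi_sum x : xi x = \sum_i x 0 i *: chart (psii i).
Proof.
have hh j : half_sum (psiR psi x) j = \sum_i x 0 i * half_sum (psii i) j.
  rewrite /half_sum /cE /cL /psiR -big_split /= mulr_suml; apply: eq_bigr => i _.
  by rewrite /psii; field.
apply/rowP => k; rewrite summxE mxE; case: ifP => k0.
  rewrite (eq_bigr _ (fun j _ => hh j)) exchange_big /=; apply: eq_bigr => i _.
  by rewrite !mxE k0 mulr_sumr.
rewrite (eq_bigr _ (fun j _ => hh j.-1)) exchange_big /=; apply: eq_bigr => i _.
by rewrite !mxE k0 mulr_sumr.
Qed.

Lemma xiD x y : xi (x + y) = xi x + xi y.
Proof. by rewrite !xi_sum -big_split; apply: eq_bigr => i _; rewrite !mxE scalerDl. Qed.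
Lemma xiZ a x : xi (a *: x) = a *: xi x.
Proof. by rewrite !xi_sum scaler_sumr; apply: eq_bigr => i _; rewrite !mxE scalerA. Qed.

Lemma balanced_xi x : balanced (xi x).
Proof. exact: balanced_chart. Qed.

Lemma eps_inv_psiR x : eps_inv (psiR psi x).
Proof.
have [h _] := iso; apply: eps_invP => i hi.
have e j : cE (psiR psi x) j - cL (psiR psi x) j = \sum_l x 0 l * (cE (psii l) j - cL (psii l) j).
  by rewrite /cE /cL /psiR -sumrB; apply: eq_bigr => l _; rewrite mulrBr.
rewrite (eq_bigr _ (fun j _ => e j.-1)) e exchange_big mulr_sumr; apply: eq_bigr => l _ /=.
by rewrite -mulr_sumr eps_inv_diff //; [ring|exact: h].
Qed.

Lemma bL_xi x y : bL M x y = lor (xi x) (xi y).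
Proof.
have [h [hM _]] := iso; rewrite !xi_sum lor_suml /bL mxE.
transitivity (\sum_i \sum_j x 0 i * y 0 j * (M i j)%:~R).
  rewrite exchange_big; apply: eq_bigr => j _; rewrite !mxE mulr_suml; apply: eq_bigr => i _.
  by rewrite !mxE; ring.
apply: eq_bigr => i _; rewrite lorZl lorC lor_suml mulr_sumr; apply: eq_bigr => j _.
by rewrite lorZl lorC -bY_chart ?hM //; [ring|exact: h].
Qed.

Definition intV (r : 'rV[int]_10) : 'rV[R]_10 := map_mx (fun z : int => z%:~R) r.

Lemma bL_int r r' : bL M (intV r) (intV r') = ((r *m M *m r'^T) 0 0)%:~R.
Proof.
rewrite /bL !mxE rmorph_sum; apply: eq_bigr => j _; rewrite !mxE rmorphM rmorph_sum; congr (_ * _).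
by apply: eq_bigr => i _; rewrite !mxE rmorphM.
Qed.

Lemma om_preimage k : (k < 10)%N -> exists z, xi (intV z) = toR R (om k).
Proof.
move=> hk; have [_ [_ surj]] := iso; have [c ec <-] := om_rep R hk.
by have [z /chart_numeq e] := surj c ec; exists z.
Qed.

Lemma lattice_surj l : balanced l -> exists r, xi (intV r) = toR R l.
Proof.
move=> bl; rewrite (om_expand (balanced_toR R bl)).
have : forall k, k \in iota 0 10 -> (k < 10)%N by move=> k; rewrite mem_iota.
elim: (iota 0 10) => [|k s IH] hs.
  exists 0; rewrite big_nil xi_sum big1 // => i _; by rewrite !mxE scale0r.
have [|r hr] := IH; first by move=> j js; apply: hs; rewrite inE js orbT.
have [z hz] := om_preimage (hs k (mem_head _ _)).
exists (lor l (al k) *: z + r).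
have -> : intV (lor l (al k) *: z + r) = (lor l (al k))%:~R *: intV z + intV r.
  by apply/rowP => i; rewrite !mxE rmorphD rmorphM.
by rewrite big_cons xiD xiZ hz hr pair_toR.
Qed.

(** Chart coordinates are a priori half-integral. But the [om k] come from integral vectors and [M]
    is integral, so the products with the [om k] are integers; so are those with the [al k],
    integral combinations of the [om k], and these are the coordinates in the dual basis. *)
Lemma lattice_int r : exists2 l, balanced l & xi (intV r) = toR R l.
Proof.
have hint k : (k < 10)%N -> exists n : int, pairR (xi (intV r)) (om k) = n%:~R.
  move=> hk; have [z hz] := om_preimage hk.
  by rewrite /pairR -hz -bL_xi bL_int; eexists.
have hal k : (k < 10)%N -> exists n : int, pairR (xi (intV r)) (al k) = n%:~R.
  move=> hk; rewrite /pairR (om_expand (balanced_toR R (proj1 (root_al hk)))).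
  rewrite lorC lor_suml big_seq; apply: (big_ind (fun x : R => exists n : int, x = n%:~R)).
  - by exists 0.
  - by move=> _ _ [n ->] [n' ->]; exists (n + n'); rewrite rmorphD.
  move=> j; rewrite mem_iota => hj; have [n en] := hint j hj.
  by exists (lor (al k) (al j) * n); rewrite lorZl pair_toR (lorC (toR R (om j))) -/(pairR (xi (intV r)) (om j)) en rmorphM.
rewrite (om_expand (balanced_xi (intV r))) big_seq.
apply: (big_ind (fun x : 'rV[R]_11 => exists2 l, balanced l & x = toR R l)).
- exists 0; last by rewrite -(scale0r (0 : vec)) toRZ scale0r.
  by rewrite /balanced big1 ?coord0 ?mulr0 // => i _; rewrite coord0.
- move=> _ _ [l bl ->] [l' bl' ->]; exists (l + l'); first exact: balancedD.
  by rewrite toRD.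
move=> k; rewrite mem_iota => hk; have [n ->] := hal k hk.
by exists (n *: om k); [apply/balancedZ/balanced_om|rewrite toRZ].
Qed.

Lemma root_lattice r : root10 M r -> exists2 l, is_root l & xi (intV r) = toR R l.
Proof.
move=> rr; have [l bl e] := lattice_int r; exists l => //; split=> //.
apply: (@intr_inj R); rewrite -pair_toR /pairR -e -bL_xi bL_int; by rewrite rr.
Qed.

Lemma lattice_root l : is_root l -> exists2 r, root10 M r & xi (intV r) = toR R l.
Proof.
move=> [bl ll]; have [r e] := lattice_surj bl; exists r => //.
by apply: (@intr_inj R); rewrite -bL_int bL_xi e -/(pairR _ _) pair_toR ll.
Qed.

Lemma walls_xi x : walls M x <-> exists2 l, is_root l & pairR (xi x) l = 0.
Proof.
split=> [[r [rr e]]|[l hl e]].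
  have [l hl el] := root_lattice rr; exists l => //.
  by rewrite /pairR -el lorC -bL_xi.
have [r rr er] := lattice_root hl; exists r; split=> //.
by rewrite -/(intV r) bL_xi er lorC.
Qed.

Lemma PY_xi x : PY (psiR psi x) <-> timelike (xi x).
Proof.
rewrite /PY bY_chart ?bY_sum_ubar; last exact: eps_inv_psiR.
by split=> [[h1 h2]|[_ h1 h2]]; split=> //; exact: balanced_xi.
Qed.

Lemma DY_xi x : DY (psiR psi x) <->
  timelike (xi x) /\ (forall e, e \in walls20 -> 0 <= pairR (xi x) e).
Proof.
rewrite /DY; split=> [[/PY_xi tx h]|[tx h]]; split.
- exact: tx.
- move=> e /wall20P[i hi [->|->]]; have [h1 h2] := h (aidx (inord i)).
    by rewrite /pairR /ub toR_ivec -bY_ubar.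
  by rewrite /pairR /vb toR_ivec -/(vb R i) -vpair_chart.
- exact/PY_xi.
- apply: forall_aidx => i hi; rewrite bY_ubar // vpair_chart //.
have := h _ (ub_wall hi); have := h _ (vb_wall hi).
  by rewrite /pairR /ub /vb !toR_ivec.
Qed.

End Lattice.

Local Open Scope classical_set_scope.

Lemma comb_gt0 (R : realDomainType) (a b t : R) : 0 < a -> 0 < b -> 0 <= t -> t <= 1 ->
  0 < (1 - t) * a + t * b.
Proof. by move=> a0 b0 t0 t1; have [ab|ab] := lerP a b; nra. Qed.

Lemma timelike_comb (R : archiRealFieldType) (a b : 'rV[R]_11) (t : R) : timelike a -> timelike b ->
  0 < t <= 1 -> timelike ((1 - t) *: a + t *: b).
Proof.
move=> [ba aa a0] [bb bb' b0] /andP[t0 t1]; have ab := lor_gt0 aa bb' a0 b0.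
have s0 : 0 <= 1 - t by lra.
split; first by apply: balancedD; apply: balancedZ.
  have -> : lor ((1 - t) *: a + t *: b) ((1 - t) *: a + t *: b)
    = (1 - t) ^+ 2 * lor a a + 2 * (1 - t) * t * lor a b + t ^+ 2 * lor b b.
    by rewrite !(lorDl, lorDr, lorZl, lorZr) (lorC b a); ring.
  apply: ltr_wpDl; last by rewrite mulr_gt0 // exprn_gt0.
  by apply: addr_ge0; rewrite !mulr_ge0 ?sqr_ge0 // ltW.
rewrite coordD !coordZ; apply: ltr_wpDl; last by rewrite mulr_gt0.
by rewrite mulr_ge0 // ltW.
Qed.

Definition Idx := ('I_496 * 'I_240 * 'I_119 * 'I_64)%type.
Definition param (p : Idx) : params :=
  let: (i, j, k, l) := p in
  (nth [::] (level 0) i, nth [::] (level 1) j, nth [::] (level 2) k, nth [::] (level 3) l).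

Lemma wf_param p : wf_params (param p).
Proof.
case: p => [[[i j] k] l]; have [s0 s1 s2 s3] := size_level.
by apply/and4P; split; apply: mem_nth; rewrite (s0, s1, s2, s3); apply: ltn_ord.
Qed.

Lemma param_inj : injective param.
Proof.
move=> [[[i j] k] l] [[[i' j'] k'] l'] [].
have [s0 s1 s2 s3] := size_level.
have inj m n (a b : 'I_n) : (m < 4)%N -> size (level m) = n ->
    nth [::] (level m) a = nth [::] (level m) b -> a = b.
  move=> hk sk /eqP; rewrite nth_uniq ?sk; try exact: ltn_ord; try exact: uniq_level.
  by move=> /eqP; apply: val_inj.
by move=> /(inj 0%N _ _ _ isT s0) -> /(inj 1%N _ _ _ isT s1) -> /(inj 2%N _ _ _ isT s2) ->
  /(inj 3%N _ _ _ isT s3) ->.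
Qed.

Lemma param_surj b : wf_params b -> exists p, param p = b.
Proof.
case: b => [[[b1 b2] b3] b4] /and4P[h1 h2 h3 h4]; have [s0 s1 s2 s3] := size_level.
move: (h1) (h2) (h3) (h4); rewrite -!index_mem s0 s1 s2 s3 => i1 i2 i3 i4.
by exists (Ordinal i1, Ordinal i2, Ordinal i3, Ordinal i4); rewrite /param /= !nth_index.
Qed.

(** * Connected components of the complement of the walls *)

Section Topology.
Variables (R : realType) (M : 'M[int]_10) (h0 : 'rV[R]_10) (psi : 'I_10 -> Gen -> int).
Hypothesis iso : isometry_to_SY R M psi.
Hypothesis coneE : forall x : 'rV[R]_10, poscone M h0 x <-> PY (psiR psi x).
Implicit Types x y : 'rV[R]_10.

Let xi := xi (R := R) psi.
Let F (l : vec) x : R := pairR (xi x) l.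

Lemma poscone_xi x : poscone M h0 x <-> timelike (xi x).
Proof. by split=> [/coneE/(PY_xi iso)|/(PY_xi iso)/coneE]. Qed.

Lemma F_comb l x y t : F l ((1 - t) *: x + t *: y) = (1 - t) * F l x + t * F l y.
Proof. by rewrite /F /xi xiD !xiZ /pairR lorDl !lorZl. Qed.

Lemma F_continuous l : continuous (F l).
Proof.
pose a i := pairR (chart (psii R psi i)) l.
have -> : F l = (fun x => \sum_i x 0 i * a i).
  apply/funext => x; rewrite /F /xi xi_sum /pairR lor_suml.
  by apply: eq_bigr => i _; rewrite lorZl.
elim: (index_enum _) => [|i s IH].
  have -> : (fun x => \sum_(i <- [::]) x 0 i * a i) = cst 0.
    by apply/funext => x; rewrite big_nil.
  exact: cst_continuous.
have -> : (fun x => \sum_(j <- i :: s) x 0 j * a j)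
    = (fun x => x 0 i * a i) \+ (fun x => \sum_(j <- s) x 0 j * a j).
  by apply/funext => x; rewrite big_cons.
have hi : continuous (fun x : 'rV[R]_10 => x 0 i * a i).
  move=> x.
  exact: (continuous_comp (@coord_continuous R 1 10 0 i x) (@mulrr_continuous R (a i) _)).
by move=> x; exact: (@continuousD R R^o _ _ _ x (hi x) (IH x)).
Qed.

Definition same_side x : set 'rV[R]_10 :=
  [set y | poscone M h0 y /\ forall l, is_root l -> 0 < F l x * F l y].

Lemma poscone_comb x y t : poscone M h0 x -> poscone M h0 y -> 0 < t <= 1 ->
  poscone M h0 ((1 - t) *: x + t *: y).
Proof.
move=> /poscone_xi tx /poscone_xi ty ht; apply/poscone_xi.
by rewrite /xi xiD !xiZ; apply: timelike_comb.
Qed.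

Lemma path_continuous x y : continuous (fun t : R => (1 - t) *: x + t *: y).
Proof.
have -> : (fun t : R => (1 - t) *: x + t *: y) = (fun t : R => x + t *: (y - x)).
  apply/funext => t; rewrite scalerBr scalerBl scale1r addrAC -addrA addrC -!addrA.
  by congr (_ + _); rewrite addrC.
by move=> t; apply: cvgD; [apply: cvg_cst|apply: cvgZr_tmp; apply: cvg_id].
Qed.

Lemma off_walls x l : (poscone M h0 `\` walls M) x -> is_root l -> F l x != 0.
Proof.
by move=> [_ nw] hl; apply/eqP => e; apply: nw; apply/(walls_xi iso); exists l.
Qed.

(** The image of a component under [F l] is an interval avoiding 0, so signs are constant on it.
    Conversely, the segment between two points with the same signs stays in the cone and off the
    mirrors. *)
Lemma component_same_side x : (poscone M h0 `\` walls M) x ->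
  connected_component (poscone M h0 `\` walls M) x = same_side x.
Proof.
move=> hx; apply/seteqP; split=> y.
  move=> cy; have [py _] := connected_component_sub cy.
  split=> // l hl; rewrite ltNge; apply/negP => neg.
  have : connected (F l @` connected_component (poscone M h0 `\` walls M) x).
    apply: connected_continuous_connected; first exact: component_connected.
    by apply: continuous_subspaceT; apply: F_continuous.
  move=> /connected_intervalP itv.
  have ix : (F l @` connected_component (poscone M h0 `\` walls M) x) (F l x).
    by exists x => //; apply: connected_component_refl.
  have iy : (F l @` connected_component (poscone M h0 `\` walls M) x) (F l y) by exists y.
  have [z cz z0] : (F l @` connected_component (poscone M h0 `\` walls M) x) 0.
    have [le|lt] := lerP (F l x) 0.
      by apply: (itv _ _ ix iy); rewrite le; have := off_walls hx hl; nra.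
    by apply: (itv _ _ iy ix); rewrite (ltW lt) andbT; nra.
  by have := off_walls (connected_component_sub cz) hl; rewrite z0 eqxx.
move=> [py sy]; have [px _] := hx.
pose g t := (1 - t) *: y + t *: x.
suff sub_ : g @` `[0, 1] `<=` connected_component (poscone M h0 `\` walls M) x.
  by apply: sub_; exists 0; rewrite /g ?subr0 ?scale1r ?scale0r ?addr0 //= in_itv /= lexx ler01.
apply: connected_component_max.
- by exists 1; rewrite /g ?subrr ?scale1r ?scale0r ?add0r //= in_itv /= lexx ler01.
- move=> _ [t /= + <-]; rewrite in_itv /= => /andP[t0 t1]; split.
    have [->|tn0] := eqVneq t 0; first by rewrite /g subr0 scale1r scale0r addr0.
    by apply: poscone_comb => //; rewrite lt_def tn0 t0.
  move=> /(walls_xi iso)[l hl]; rewrite -/(F l _) F_comb => e.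
  have xx : 0 < F l x * F l x by rewrite -expr2 exprn_even_gt0 //= off_walls.
  have := comb_gt0 (sy l hl) xx t0 t1.
  by rewrite mulrCA (mulrCA t) -mulrDr e mulr0 ltxx.
apply: connected_continuous_connected; first exact: segment_connected.
by apply: continuous_subspaceT; apply: path_continuous.
Qed.

(** A point y satisfying the weak inequalities is the limit of (1 - t)y + t x for t > 0 tending to
    0, and these points satisfy the strict ones. *)
Lemma closure_component x : (poscone M h0 `\` walls M) x ->
  closure (connected_component (poscone M h0 `\` walls M) x) `&` poscone M h0
  = [set y | poscone M h0 y /\ forall l, is_root l -> 0 <= F l x * F l y].
Proof.
move=> hx; rewrite component_same_side //; apply/seteqP; split=> y.
  move=> [cy py]; split=> // l hl; rewrite leNgt; apply/negP => neg.
  have cF : {for y, continuous (fun z => F l x * F l z)}.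
    exact: (continuous_comp (@F_continuous l y) (@mulrl_continuous R (F l x) _)).
  have [z [[_ sz] /= nz]] := cy _ (cF _ (lt_nbhsl neg)).
  by have := sz l hl => /(lt_trans nz); rewrite ltxx.
move=> [py sy]; split=> // B By.
have /nbhs_ballP[e e0 he] : nbhs (0 : R) ((fun t : R => (1 - t) *: y + t *: x) @^-1` B).
  by apply: (path_continuous (x := y) (y := x)); rewrite subr0 scale1r scale0r addr0.
have {}e0 : 0 < e := e0; pose t := Num.min 1 (e / 2).
have t0 : 0 < t by rewrite lt_min ltr01 divr_gt0.
have t1 : t <= 1 by rewrite ge_min lexx.
exists ((1 - t) *: y + t *: x); split; last first.
  apply: he; rewrite /ball /= sub0r normrN gtr0_norm //.
  by apply: (@le_lt_trans _ _ (e / 2)); [rewrite ge_min lexx orbT|lra].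
split; first by apply: poscone_comb; [|case: hx|rewrite t0].
move=> l hl; rewrite F_comb.
have xx : 0 < F l x * F l x by rewrite -expr2 exprn_even_gt0 //= off_walls.
rewrite mulrDr mulrCA (mulrCA _ t); apply: ltr_wpDl; last exact: mulr_gt0.
by apply: mulr_ge0; [rewrite subr_ge0|exact: sy].
Qed.

(** * Vinberg chambers as images of the standard chamber *)

Definition Cset (g : seq vec) : set 'rV[R]_10 :=
  [set y | timelike (xi y) /\ forall i, (i < 10)%N -> 0 <= F (act g (al i)) y].

(** As [x] lies on no mirror, its signs on the ten images of simple roots determine its signs on all
    roots. *)
Lemma CsetE x g : (poscone M h0 `\` walls M) x -> rword g ->
  (forall i, (i < 10)%N -> 0 <= F (act g (al i)) x) ->
  closure (connected_component (poscone M h0 `\` walls M) x) `&` poscone M h0 = Cset g.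
Proof.
move=> hx hg gx; rewrite closure_component //; apply/seteqP; split=> y [].
  move=> /poscone_xi ty sy; split=> // i hi.
  have hr := root_act hg (root_al hi).
  have pos : 0 < F (act g (al i)) x by rewrite lt_def off_walls ?gx.
  by have := sy _ hr; rewrite pmulr_rge0.
move=> ty gy; split; first exact/poscone_xi.
have key l : is_root l -> 0 < F l x -> 0 <= F l y.
  move=> hl pos; apply: (chamber_root hg gy hl).
  rewrite lt_def rho_regular //= leNgt; apply/negP => neg.
  have : 0 <= F (- l) x.
    by apply: (chamber_root hg gx (rootN hl)); rewrite lorNr oppr_gt0.
  by rewrite /F pairRN oppr_ge0 leNgt pos.
move=> l hl; have := off_walls hx hl; rewrite neq_lt => /orP[neg|pos].
  have := key (- l) (rootN hl); rewrite /F !pairRN oppr_gt0 oppr_ge0 => /(_ neg) le.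
  by rewrite nmulr_rge0.
by rewrite pmulr_rge0 // key.
Qed.

Lemma interior_point g : rword g -> exists x, [/\ (poscone M h0 `\` walls M) x,
  xi x = toR R (act g rho) & forall i, (i < 10)%N -> 0 <= F (act g (al i)) x].
Proof.
move=> hg; have bg := balanced_act hg balanced_rho.
have [r er] := lattice_surj iso bg; exists (intV R r).
have tx : timelike (xi (intV R r)).
  rewrite /xi er; split; first exact: balanced_toR.
    by rewrite -/(pairR _ _) pair_toR lor_act // rho_norm.
  by rewrite coord_toR ltr0z coord_act_rho.
split=> //.
  split; first exact/poscone_xi.
  move=> /(walls_xi iso)[l hl]; rewrite er pair_toR => /eqP; rewrite intr_eq0.
  by apply/negP/rho_regular.
by move=> i hi; rewrite /F /xi er pair_toR lor_act // rho_al // ler01.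
Qed.

Lemma vinbergP C : vinberg_chamber M h0 C <-> exists2 g, rword g & C = Cset g.
Proof.
split=> [[x [hx ->]]|[g hg ->]].
  have [px _] := hx; have [g hg gx] := chamber_ex (proj1 (poscone_xi x) px).
  by exists g => //; apply: CsetE.
have [x [hx _ gx]] := interior_point hg; exists x; split=> //.
by rewrite (CsetE hx hg gx).
Qed.

Let D : set 'rV[R]_10 := [set x | DY (psiR psi x)].

Lemma Cset_sub g : rword g -> Cset g `<=` D <-> inD (act g rho).
Proof.
move=> hg; split=> [sub_ e ew|hD y [ty gy]]; last first.
  apply/(DY_xi iso); split=> // e ew.
  by apply: (chamber_root hg gy (root_wall ew)); apply: hD.
have [x [hx ex gx]] := interior_point hg.
have /(DY_xi iso)[_ h] : D x.
  by apply: sub_; split=> //; apply/poscone_xi; case: hx.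
have := h e ew; rewrite -/(xi x) ex pair_toR ler0z le_eqVlt eq_sym.
by rewrite (negbTE (rho_regular hg (root_wall ew))).
Qed.

Lemma D_cover : D = \bigcup_(C in [set C | vinberg_chamber M h0 C /\ C `<=` D]) C.
Proof.
apply/seteqP; split=> [y|y [C [_ sub_] /sub_ //]].
move=> /(DY_xi iso)[ty wy]; have [g [hg gy hD]] := chamber_around ty wy.
exists (Cset g); last by split.
by split; [apply/vinbergP; exists g|apply/Cset_sub].
Qed.

Lemma chamber_of_param (p : Idx) : exists g, [/\ rword g, inD (act g rho) &
  forall k, (k < 4)%N -> cl (act (rev g) (chainv k)) = cl (act (pword (param p)) (chainv k))].
Proof.
(* The word starts from the inverse of [pword (param p)]; reducing multiplies on the left by a word
   trivial on V4, which leaves the quadruple of the inverse unchanged. *)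
have hw := rword_pword (wf_param p); have [g sg hD] := reduce (rword_rev hw).
have hg : rword (g ++ rev (pword (param p))) by apply: rword_cat; [case: sg|apply: rword_rev].
exists (g ++ rev (pword (param p))); split=> // k hk.
by rewrite rev_cat revK act_cat; apply/cl_act_eq/stab_chainv => //; apply: stab_rev.
Qed.

Lemma Cset_eq g g' : rword g -> rword g' -> Cset g = Cset g' ->
  forall l, balanced l -> act g l = act g' l.
Proof.
move=> hg hg' e; apply: chamber_unique => // i hi.
have [x [hx ex gx]] := interior_point hg.
have : Cset g' x by rewrite -e; split=> //; apply/poscone_xi; case: hx.
by case=> _ /(_ i hi); rewrite /F ex pair_toR ler0z.
Qed.

Lemma Cset_ext g g' : rword g -> rword g' -> (forall l, balanced l -> act g l = act g' l) ->
  Cset g = Cset g'.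
Proof.
move=> hg hg' e; apply/seteqP; split=> y [ty h]; split=> // i hi; have [b _] := root_al hi.
  by rewrite -e //; apply: h.
by rewrite e //; apply: h.
Qed.

Lemma card_chambers :
  ([set C | vinberg_chamber M h0 C /\ C `<=` D] #= `I_#|{: Idx}|)%card.
Proof.
have [G hG] := choice chamber_of_param.
pose f (j : 'I_#|{: Idx}|) := Cset (G (enum_val j)).
have -> : [set C | vinberg_chamber M h0 C /\ C `<=` D] = f @` setT.
  apply/seteqP; split=> C.
    move=> [/vinbergP[g hg ->] /(Cset_sub hg) hD].
    have [b wb eb] := params_surj (rword_rev hg); have [p ep] := param_surj wb.
    exists (enum_rank p) => //; rewrite /f enum_rankK; have [hg' hD' e] := hG p.
    apply: Cset_ext => //; apply: inD_unique => // k hk.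
    by rewrite e // ep eb.
  move=> [j _ <-]; have [hg hD _] := hG (enum_val j).
  by split; [apply/vinbergP; exists (G (enum_val j))|apply/Cset_sub].
have f_inj : {in setT &, injective f}.
  move=> j j' _ _ e; have [hg hD eg] := hG (enum_val j); have [hg' hD' eg'] := hG (enum_val j').
  have act_eq := Cset_eq hg hg' e.
  apply/enum_val_inj/param_inj/params_inj; try exact: wf_param.
  move=> k hk; rewrite -eg // -eg' //; congr cl.
  have [bv _] := root_chainv hk; have hr := rword_rev hg'.
  by rewrite -[in LHS](actKV (chainv k) hg') -act_eq ?actK //; apply: balanced_act.
apply: (card_eq_trans (inj_card_eq f_inj)).
have -> : `I_#|{: Idx}| = (@nat_of_ord #|{: Idx}|) @` setT.
  apply/seteqP; split=> [k /= hk|_ [j _ <-] /=]; last exact: ltn_ord.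
  by exists (Ordinal hk).
rewrite card_eq_sym; apply: inj_card_eq => j j' _ _; exact: val_inj.
Qed.

End Topology.

Lemma card_Idx : #|{: Idx}| = (2 ^ 14 * 3 * 5 * 7 * 17 * 31)%N.
Proof.
rewrite !card_prod !card_ord.
have -> : 496%N = (2 ^ 4 * 31)%N by [].
have -> : 240%N = (2 ^ 4 * 3 * 5)%N by [].
have -> : 119%N = (7 * 17)%N by [].
have -> : 64%N = (2 ^ 6)%N by [].
have -> : (2 ^ 14 = 2 ^ 4 * 2 ^ 4 * 2 ^ 6)%N by rewrite -!expnD.
(* The factors become variables, so that no unary numeral of the size of the count is evaluated. *)
move: (2 ^ 4)%N (2 ^ 6)%N => a b; move: 3%N 5%N 7%N 17%N 31%N => c d e f g.
ring.
Qed.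

Theorem theorem1p8 (R : realType) (M : 'M[int]_10) (h0 : 'rV[R]_10)
    (psi : 'I_10 -> Gen -> int) :
  even_unimodular M ->
  0 < bL M h0 h0 ->
  isometry_to_SY R M psi ->
  (forall x : 'rV[R]_10, poscone M h0 x <-> PY (psiR psi x)) ->
  union_of_exactly (2 ^ 14 * 3 * 5 * 7 * 17 * 31)%N
    [set x | DY (psiR psi x)] (vinberg_chamber M h0).
Proof.
move=> _ _ iso coneE; split; last exact: D_cover.
rewrite -card_Idx; exact: card_chambers.
Qed.
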